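(* Let $X$ be a complex Banach space, $T\in B(X)$ and $\beta\ge1$. The following are equivalent: (1) $T$ is $\beta$-Kreiss bounded. (2) For each $\gamma>1$, $\lambda T$ is $C_\gamma^{(\beta)}$-bounded uniformly for all $\lambda\in\mathbb{T}$, i.e. $\sup_{\lambda\in\mathbb{T}} C_\gamma^{(\beta)}(\lambda T)<\infty$. (3) There is at least one $\gamma>1$ such that $\sup_{\lambda\in\mathbb{T}} C_\gamma^{(\beta)}(\lambda T)<\infty$.
   Context: $\mathbb{N}=\{1,2,\dots\}$; $\mathbb{D}$ is the open unit disk and $\mathbb{T}$ its boundary; $R(\lambda,T)=(\lambda I-T)^{-1}$. $T$ is $\beta$-Kreiss bounded if $\sigma(T)\subset\overline{\mathbb{D}}$ and there is $C>0$ with $\|R(\lambda,T)\|\le\frac{C}{(|\lambda|-1)^{\beta}}$ for all $1<|\lambda|<2$. For $\gamma>0$, the Cesàro sums of order $\gamma$ are $S_n^{\gamma}(T):=\sum_{j=0}^n A_{n-j}^{\gamma-1}T^j$, where the numbers $A_n^{\delta}$ ($\delta>-1$) are defined by $(1-z)^{-(\delta+1)}=\sum_{n=0}^\infty A_n^{\delta}z^n$ for $|z|<1$. For $\gamma>0$, $\beta\ge1$, $T$ is $C_\gamma^{(\beta)}$-bounded if there is $C>0$ with $\|S_n^{\gamma}(T)\|\le C n^{\gamma+\beta-1}$ for all $n\in\mathbb{N}$; the smallest such $C$ is denoted $C_\gamma^{(\beta)}(T)$ (with $C_\gamma^{(\beta)}(T)=\infty$ if $T$ is not $C_\gamma^{(\beta)}$-bounded).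 *)

(* Defs.v *)
From HB Require Import structures.
From mathcomp Require Import all_boot all_order all_algebra.
From mathcomp Require Import complex.
From mathcomp Require Import all_classical all_reals all_analysis.

Set Implicit Arguments.
Unset Strict Implicit.
Unset Printing Implicit Defensive.

Import Order.TTheory GRing.Theory Num.Theory.
Import numFieldNormedType.Exports.

Local Open Scope classical_set_scope.
Local Open Scope ring_scope.
Local Open Scope complex_scope.

(* The norm of a normed module over R[i] takes its values in R[i], where
   [a <= b] requires equal imaginary parts; [complex.Re `|x|] is that norm as
   an element of R. *)

Section Operators.
Variables (R : realType) (X : completeNormedModType R[i]).
Implicit Types (T S : X -> X) (l : R[i]).

(* The value is +oo when S is unbounded on the unit ball. *)
Definition opnorm S : \bar R :=
  ereal_sup [set (complex.Re `|S x|)%:E | x in [set x : X | `|x| <= 1]].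

Definition is_resolvent l T S : Prop :=
  [/\ linear S, continuous S,
      forall x, S (l *: x - T x) = x &
      forall x, l *: S x - T (S x) = x].

Definition spectrum T : set R[i] :=
  ~` [set l | exists S, is_resolvent l T S].

(* (l I - T)^-1, arbitrary when l is in the spectrum of T *)
Definition resolvent l T : X -> X := get (is_resolvent l T).

Definition kreiss_bounded (beta : R) T : Prop :=
  spectrum T `<=` [set l | `|l| <= 1] /\
  exists C : R, 0 < C /\
    forall l, 1 < `|l| < 2 ->
      (opnorm (resolvent l T) <= (C / (complex.Re `|l| - 1) `^ beta)%R%:E)%E.

End Operators.

(* The coefficients A_n^delta of the generating function
   (1 - z)^(-(delta + 1)).  They are real, and a power series is determined by
   its sum on ]-1, 1[, so the identity is required for real z only; this avoids
   fixing a branch of the complex power. *)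
Definition cesaro_number (R : realType) (delta : R) : nat -> R :=
  get [set A : nat -> R | forall z : R, `|z| < 1 ->
    series (fun n => A n * z ^+ n) @ \oo --> (1 - z) `^ (- (delta + 1))].

Section Cesaro.
Variables (R : realType) (X : completeNormedModType R[i]).
Implicit Types (T : X -> X) (gamma beta : R).

Definition cesaro_sum gamma T (n : nat) : X -> X := fun x =>
  \sum_(j < n.+1) (cesaro_number (gamma - 1) (n - j))%:C *: iter j T x.

Definition cesaro_bound gamma beta T (C : R) : Prop :=
  0 < C /\ forall n : nat, (0 < n)%N ->
    (opnorm (cesaro_sum gamma T n) <= (C * n%:R `^ (gamma + beta - 1))%R%:E)%E.

(* +oo when no bound exists, the infimum of the empty set being +oo *)
Definition cesaro_const gamma beta T : \bar R :=
  ereal_inf [set C%:E | C in [set C : R | cesaro_bound gamma beta T C]].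

Definition uniformly_cesaro_bounded gamma beta T : Prop :=
  (ereal_sup [set cesaro_const gamma beta (fun x => l *: T x)
             | l in [set l : R[i] | `|l| = 1]]%R < +oo)%E.

End Cesaro.

(* Main.v *)
(* The Cesaro sums S_n^gamma(l T) are the coefficients of
   (1 - z)^(-gamma) (I - z l T)^(-1).

   Kreiss => Cesaro.  Write (1 - z)^(-gamma) = h(z)^2 with
   h(z) = (1 - z)^(-gamma/2).  Averaging z^(-n) h(z)^2 (I - z l T)^(-1) over the
   N-th roots of unity on the circle of radius r = (n + 1) / (n + 2) recovers
   S_n^gamma(l T); the resolvent contributes O(n^beta), and by Parseval the mean
   of |h|^2 is sum_i b_i^2 r^(2i), where b_i^2 <= K A_i^(gamma - 2), hence
   O((1 - r)^(1 - gamma)).  Only finite sums occur; the truncation error is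
   controlled by r^J T^J -> 0 for r < 1, which is the spectral radius formula.

   Cesaro => Kreiss.  For z = r l with r = |z| the series
   (1 - r)^gamma sum_n r^n S_n^gamma(l T) converges to (I - z T)^(-1), and
   n^p r^n sums to O((1 - r)^(-p - 1)); only the real power (1 - r)^gamma is
   needed because the rotation l is absorbed in the operator. *)
Require Import Defs.
From HB Require Import structures.
From mathcomp Require Import all_boot all_order all_algebra.
From mathcomp Require Import complex.
From mathcomp Require Import all_classical all_reals all_analysis.
From mathcomp Require Import cyclic separable cyclotomic.
From mathcomp Require Import ring lra zify.

Import Order.TTheory GRing.Theory Num.Theory.
Import numFieldNormedType.Exports.

Set Implicit Arguments.
Unset Strict Implicit.
Unset Printing Implicit Defensive.

Local Open Scope classical_set_scope.
Local Open Scope ring_scope.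
Local Open Scope complex_scope.

(** * Binomial coefficients and the Cesaro numbers *)

Section BinomialSeries.
Variable R : realType.
Implicit Types (a b x z : R) (n : nat).

(* The number A_n^(a - 1) of the paper. *)
Definition binc a n : R := \prod_(i < n) ((a + i%:R) / i.+1%:R).

Lemma binc0 a : binc a 0 = 1.
Proof. by rewrite /binc big_ord0. Qed.

Lemma bincS a n : binc a n.+1 = binc a n * ((a + n%:R) / n.+1%:R).
Proof. by rewrite /binc big_ord_recr. Qed.

Lemma bincSE a n : n.+1%:R * binc a n.+1 = (a + n%:R) * binc a n.
Proof. by rewrite bincS mulrCA [X in _ * X]mulrC divfK ?pnatr_eq0// mulrC. Qed.

Lemma binc_gt0 a n : 0 < a -> 0 < binc a n.
Proof.
move=> a0; apply: prodr_gt0 => i _.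
by rewrite divr_gt0 ?ltr0n// ltr_wpDr.
Qed.

(** Both sides are the rising product a (a + 1) ... (a + n) divided by n!. *)
Lemma binc_shift a n : a * binc (a + 1) n = (a + n%:R) * binc a n.
Proof.
elim: n => [|n IH]; first by rewrite !binc0 addr0.
rewrite bincS mulrA IH -mulrA [RHS]mulrC bincS -[RHS]mulrA.
have n0 : n.+1%:R != 0 :> R by rewrite pnatr_eq0.
by rewrite -natr1; field; rewrite natr1.
Qed.

(** This compares coefficients in (1 - z) (1 - z)^(-(a + 1)) = (1 - z)^(-a). *)
Lemma binc_pascal a n : binc (a + 1) n.+1 = binc (a + 1) n + binc a n.+1.
Proof.
have n0 : n.+1%:R != 0 :> R by rewrite pnatr_eq0.
apply: (mulfI n0); rewrite mulrDr !bincSE -(binc_shift a) -mulrDl.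
by rewrite -natr1; ring.
Qed.

(* The derivative of the convolution obeys the same recursion as [binc]. *)
Lemma binc_conv a b n :
  \sum_(i < n.+1) binc a i * binc b (n - i) = binc (a + b) n.
Proof.
elim: n => [|n IH]; first by rewrite big_ord1 !binc0 mulr1.
have n0 : n.+1%:R != 0 :> R by rewrite pnatr_eq0.
apply: (mulfI n0); rewrite bincSE -IH mulr_sumr.
(* The product rule: n + 1 = i + (n + 1 - i). Each half then loses its vanishing end term, and
   [bincSE] brings both back to the range of the induction hypothesis. *)
transitivity (\sum_(i < n.+2) (i%:R * binc a i) * binc b (n.+1 - i)
   + \sum_(i < n.+2) binc a i * ((n.+1 - i)%N%:R * binc b (n.+1 - i))).
  rewrite -big_split; apply: eq_bigr => i _ /=.
  rewrite natrB; last by rewrite -ltnS ltn_ord.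
  by ring.
rewrite big_ord_recl /= mulr0n !mul0r add0r.
rewrite [X in _ + X]big_ord_recr /= subnn mulr0n mul0r mulr0 addr0.
rewrite -big_split mulr_sumr; apply: eq_bigr => i _ /=.
rewrite /bump /= add1n subSS bincSE subSn; last by rewrite -ltnS ltn_ord.
rewrite bincSE natrB; last by rewrite -ltnS ltn_ord.
by ring.
Qed.

(* With e := 2a - 1 the n-th factors satisfy
   (a + n)^2 = (e + n)(n + 1) + (a - 1)^2, so the quotient of the two sides is
   bounded by the convergent product of the 1 + (a - 1)^2 / (n (n + 1)). *)
Lemma binc_sqr_le a : 2^-1 < a ->
  exists2 C, 0 < C & forall n, binc a n ^+ 2 <= C * binc (2 * a - 1) n.
Proof.
move=> a2; set e := 2 * a - 1; have e0 : 0 < e by rewrite /e; lra.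
have a0 : 0 < a by lra.
pose D := (a - 1) ^+ 2.
have D0 : 0 <= D by rewrite sqr_ge0.
pose K := a ^+ 2 / e * expR D.
have K0 : 0 < K by rewrite mulr_gt0 ?expR_gt0// divr_gt0// exprn_gt0.
(* The sum of D / (k (k + 1)) over k > n telescopes to D / (n + 1); the extra exponential reserves
   this tail so that the induction closes. [K] makes the case n = 0 an equality. *)
suff H n : binc a n.+1 ^+ 2 <= K * expR (- (D / n.+1%:R)) * binc e n.+1.
  exists (1 + K) => [|n]; first by rewrite addr_gt0.
  case: n => [|n]; first by rewrite !binc0 expr1n mulr1; lra.
  apply: le_trans (H n) _; apply: ler_wpM2r; first by rewrite ltW ?binc_gt0.
  rewrite (@le_trans _ _ K)//; last by lra.
  apply: ler_piMr; first exact: ltW.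
  by rewrite expR_le1 oppr_le0 divr_ge0.
elim: n => [|n IH].
  rewrite !bincS !binc0 !mul1r !addr0 !divr1 /K expRN -(mulrA (a ^+ 2 / e)).
  by rewrite divff ?expR_eq0// mulr1 divfK// gt_eqF.
rewrite bincS [in leRHS]bincS exprMn.
set m : R := n.+1%:R; have m0 : 0 < m by rewrite ltr0n.
have -> : n.+2%:R = m + 1 :> R by rewrite -[n.+2%:R]natr1.
have key : ((a + m) / (m + 1)) ^+ 2 <=
    expR (D / m - D / (m + 1)) * ((e + m) / (m + 1)).
  apply: (@le_trans _ _ ((1 + (D / m - D / (m + 1))) * ((e + m) / (m + 1)))).
    have -> : ((a + m) / (m + 1)) ^+ 2 =
       (1 + D / ((e + m) * (m + 1))) * ((e + m) / (m + 1)).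
      by rewrite /D /e; field; rewrite -/e; apply/andP; split;
        rewrite gt_eqF//; rewrite /e; lra.
    apply: ler_wpM2r; first by rewrite divr_ge0//; lra.
    rewrite lerD2l.
    have -> : D / m - D / (m + 1) = D / (m * (m + 1)).
      by field; apply/andP; split; rewrite gt_eqF//; lra.
    rewrite ler_wpM2l// lef_pV2 ?posrE ?mulr_gt0//; try lra.
    by rewrite ler_wpM2r//; lra.
  apply: ler_wpM2r; first by rewrite divr_ge0//; lra.
  exact: expR_ge1Dx.
apply: (le_trans (ler_pM _ _ IH key)); rewrite ?sqr_ge0//.
rewrite mulrACA; apply: ler_wpM2r.
  by apply: mulr_ge0; [rewrite ltW ?binc_gt0|apply: divr_ge0; lra].
rewrite -mulrA -expRD.
by have -> : - (D / m) + (D / m - D / (m + 1)) = - (D / (m + 1)) by ring.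
Qed.

End BinomialSeries.

(** * Summation of the binomial series on ]-1, 1[ *)

Section BinomialSeriesSum.
Variable R : realType.
Implicit Types (a b x z : R) (n : nat).

Lemma binc_ge0 a n : 0 <= a -> 0 <= binc a n.
Proof.
by move=> a0; apply: prodr_ge0 => i _; rewrite divr_ge0 ?addr_ge0.
Qed.

Lemma binc_le a b n : 0 <= a -> a <= b -> binc a n <= binc b n.
Proof.
move=> a0 ab; apply: ler_prod => i _; apply/andP; split.
  by rewrite divr_ge0 ?addr_ge0.
by rewrite ler_wpM2r ?invr_ge0// lerD2r.
Qed.

Lemma binc0S n : binc (0 : R) n.+1 = 0.
Proof. by rewrite /binc big_ord_recl /= addr0 !mul0r. Qed.

(** Truncated form of (1 - z) (1 - z)^(-(a + 1)) = (1 - z)^(-a): by [binc_pascal] multiplication by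
    1 - z telescopes, and only the last term is left over. *)
Lemma binc_sum_shift a z n :
  (1 - z) * (\sum_(k < n.+1) binc (a + 1) k * z ^+ k)
    + z ^+ n.+1 * binc (a + 1) n = \sum_(k < n.+1) binc a k * z ^+ k.
Proof.
elim: n => [|n IH].
  by rewrite !big_ord1 !binc0 expr0 expr1; ring.
rewrite big_ord_recr [RHS]big_ord_recr /= -IH.
have -> : binc a n.+1 = binc (a + 1) n.+1 - binc (a + 1) n.
  by rewrite binc_pascal addrC addKr.
by rewrite !exprS; ring.
Qed.

(** Induction on m: multiplying by 1 - z lowers the exponent by one, and the remainder in
    [binc_sum_shift] is nonnegative. These sums majorize the series with real exponent. *)
Lemma binc_sum_nat_le m n z : 0 <= z < 1 ->
  \sum_(k < n) binc m%:R k * z ^+ k <= (1 - z)^-1 ^+ m.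
Proof.
move=> /andP[z0 z1]; have z1' : 0 < 1 - z by rewrite subr_gt0.
suff H k : \sum_(j < k.+1) binc m%:R j * z ^+ j <= (1 - z)^-1 ^+ m.
  apply: le_trans (H n); rewrite big_ord_recr /= lerDl.
  by rewrite mulr_ge0 ?exprn_ge0 ?binc_ge0.
elim: m => [|m IH].
  rewrite big_ord_recl /= binc0 expr0 mulr1 big1 ?addr0// => i _.
  by rewrite binc0S mul0r.
rewrite exprS ler_pdivlMl//; apply: le_trans IH.
rewrite -(binc_sum_shift m%:R) natr1 lerDl.
by rewrite mulr_ge0 ?exprn_ge0 ?binc_ge0.
Qed.

Lemma is_cvg_binc a z : 0 < a -> `|z| < 1 -> cvgn (pseries (binc a) z).
Proof.
move=> a0 z1; pose r := (1 + `|z|) / 2.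
have zr : `|z| < r by rewrite /r; lra.
have r1 : r < 1 by rewrite /r; lra.
have r0 : 0 < r by rewrite /r; have := normr_ge0 z; lra.
apply: (@is_cvg_pseries_inside _ _ r); last by rewrite (gtr0_norm r0).
apply: nondecreasing_is_cvgn.
  apply: nondecreasing_series => n _ _.
  by rewrite mulr_ge0 ?exprn_ge0 ?binc_ge0 ?(ltW a0) ?(ltW r0).
(* The coefficients increase with the exponent, so the partial sums at r are bounded by those for an
   integer m above a. *)
pose m := Num.bound a.
have am : a <= m%:R by rewrite ltW// archi_boundP// ltW.
exists ((1 - r)^-1 ^+ m) => _ [n _ <-].
rewrite /pseries /series /= big_mkord.
apply: le_trans (@binc_sum_nat_le m n r _); last by rewrite (ltW r0).
apply: ler_sum => k _; apply: ler_wpM2r; [by rewrite exprn_ge0 ?ltW|by apply: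
  binc_le => //; exact: ltW].
Qed.

Lemma pseries_diffs_binc a : pseries_diffs (binc a) = a \*: binc (a + 1).
Proof. by apply/funext => n /=; rewrite /pseries_diffs bincSE -binc_shift. Qed.

Lemma pseriesZ k (f : R^nat) z : pseries (k \*: f) z = k *: pseries f z.
Proof.
apply/funext => n.
transitivity (k * \sum_(0 <= i < n) f i * z ^+ i); last by [].
rewrite mulr_sumr /pseries /series /=.
by apply: eq_bigr => i _; rewrite /= mulrA.
Qed.

Lemma is_cvg_binc_diffs a z : 0 < a -> `|z| < 1 ->
  cvgn (pseries (a \*: binc (a + 1)) z).
Proof.
by move=> a0 z1; rewrite pseriesZ; apply: is_cvgZl_tmp; apply: is_cvg_binc =>
  //; lra.
Qed.

Lemma binc_sumS a z : 0 < a -> `|z| < 1 ->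
  (1 - z) * limn (pseries (binc (a + 1)) z) = limn (pseries (binc a) z).
Proof.
move=> a0 z1.
have cv := @is_cvg_binc (a + 1) z (addr_gt0 a0 ltr01) z1.
have cva := @is_cvg_binc a z a0 z1.
have z0 : (fun n => z ^+ n.+1 * binc (a + 1) n) @ \oo --> (0 : R).
  have : (fun n => z * (binc (a + 1) n * z ^+ n)) @ \oo --> z * 0.
    by apply: cvgMl_tmp; exact: cvg_series_cvg_0 cv.
  rewrite mulr0; apply: cvg_trans; apply: near_eq_cvg; near=> n => /=.
  by rewrite exprS; ring.
apply/esym/cvg_lim => //.
have : (fun n => (1 - z) * pseries (binc (a + 1)) z n.+1
         + z ^+ n.+1 * binc (a + 1) n) @ \oo -->
        (1 - z) * limn (pseries (binc (a + 1)) z) + 0.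
  apply: cvgD => //; apply: cvgMl_tmp.
  by rewrite (cvg_shiftS (pseries (binc (a + 1)) z)).
rewrite addr0 => H; rewrite -cvg_shiftS /=; apply: cvg_trans H.
apply: near_eq_cvg; near=> n => /=.
by rewrite /pseries /series /= !big_mkord binc_sum_shift.
Unshelve. all: by end_near. Qed.

Lemma is_derive_binc_sum a z : 0 < a -> `|z| < 1 ->
  is_derive z (1 : R) (fun x => limn (pseries (binc a) x))
    (a * limn (pseries (binc (a + 1)) z)).
Proof.
move=> a0 z1; pose r := (1 + `|z|) / 2.
have zr : `|z| < r by rewrite /r; lra.
have r0 : 0 < r by rewrite /r; have := normr_ge0 z; lra.
have r1 : `|r| < 1 by rewrite (gtr0_norm r0) /r; lra.
have a10 : 0 < a + 1 by lra.
have -> : a * limn (pseries (binc (a + 1)) z)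
    = limn (pseries (pseries_diffs (binc a)) z).
  rewrite pseries_diffs_binc pseriesZ limZl_tmp//.
  exact: is_cvg_binc.
apply: (@pseries_snd_diffs _ _ r).
- exact: is_cvg_binc.
- by rewrite pseries_diffs_binc; exact: is_cvg_binc_diffs.
- have -> : pseries_diffs (pseries_diffs (binc a)) =
      (a * (a + 1)) \*: binc (a + 1 + 1).
    apply/funext => n; rewrite pseries_diffs_binc /pseries_diffs /=.
    rewrite mulrCA bincSE -binc_shift.
    by rewrite /GRing.scale /=; ring.
  rewrite pseriesZ; apply: is_cvgZl_tmp; apply: is_cvg_binc => //; lra.
- by rewrite (gtr0_norm r0).
Qed.

(** The product of the sum with (1 - x)^a has zero derivative on ]-1, 1[ and equals 1 at 0. *)
Lemma binc_sumE a z : 0 < a -> `|z| < 1 ->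
  limn (pseries (binc a) z) = (1 - z) `^ (- a).
Proof.
move=> a0 z1.
pose h x := limn (pseries (binc a) x) * (1 - x) `^ a.
have hd x : `|x| < 1 -> is_derive x (1 : R) h 0.
  move=> x1; have x0 : 0 < 1 - x by rewrite subr_gt0 (le_lt_trans (ler_norm _)).
  have d1 := is_derive_binc_sum a0 x1.
  have d2 : is_derive x (1 : R) (fun y => (1 - y) `^ a)
      (- (a * (1 - x) `^ (a - 1))).
    have := @is_derive1_comp _ (fun t : R => t `^ a) (fun y => 1 - y) x _ (-1)
      (@is_derive1_powR _ a _ x0) _.
    rewrite mulrN1; apply.
    by apply: is_derive_eq; rewrite add0r mul1r.
  rewrite /h; apply: is_derive_eq => /=.
  (* Writing the sum for a as 1 - x times the sum for a + 1 makes the two terms of the product rule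
     cancel. *)
  rewrite -(binc_sumS a0 x1) /GRing.scale /=.
  rewrite -[(1 - x) `^ a](@mulr_powRB1 _ _ a)// ?ltW//.
  by ring.
have hc : h z = h 0.
  have ab x y : `|x| < 1 -> `|y| < 1 -> x <= y -> h x = h y.
    move=> x1 y1 xy.
    have inside w : w \in `[x, y]%R -> `|w| < 1.
      rewrite in_itv /= => /andP[xw wy]; move: x1 y1; rewrite !ltr_norml.
      by move=> /andP[? ?] /andP[? ?]; apply/andP; split; lra.
    have [| |w _] := @MVT_segment _ h (fun=> 0) _ _ xy.
    - by move=> w wxy; apply: hd; apply: inside; exact: subset_itv_oo_cc.
    - apply: derivable_within_continuous => w wxy.
      by have [] := hd _ (inside _ wxy).
    - by rewrite mul0r => /eqP; rewrite subr_eq0 => /eqP.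
  have n0 : `|0 : R| < 1 by rewrite normr0.
  by case: (leP z 0) => [/ab|/ltW/ab] ->.
have h0 : h 0 = 1.
  rewrite /h subr0 powR1 mulr1; apply/cvg_lim => //.
  rewrite -cvg_shiftS; apply: cvg_near_cst; near=> n.
  rewrite /pseries /series /= big_mkord big_ord_recl /= binc0 expr0 mulr1.
  by rewrite big1 ?addr0// => i _; rewrite expr0n mulr0.
have z0 : 0 < 1 - z by rewrite subr_gt0 (le_lt_trans (ler_norm _)).
move: hc; rewrite h0 /h powRN => /(canRL (mulfK _)) ->; rewrite ?mul1r//.
by rewrite gt_eqF// powR_gt0.
Unshelve. all: by end_near. Qed.

Lemma cvg_binc a z : 0 < a -> `|z| < 1 ->
  pseries (binc a) z @ \oo --> (1 - z) `^ (- a).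
Proof. by move=> a0 z1; rewrite -binc_sumE//; exact: is_cvg_binc. Qed.

Lemma binc_sum_le a z n : 0 < a -> 0 <= z < 1 ->
  \sum_(k < n) binc a k * z ^+ k <= (1 - z) `^ (- a).
Proof.
move=> a0 /andP[z0 z1]; have z1' : `|z| < 1 by rewrite ger0_norm.
rewrite -binc_sumE//.
have -> : \sum_(k < n) binc a k * z ^+ k = pseries (binc a) z n.
  by rewrite /pseries /series /= big_mkord.
apply: nondecreasing_cvgn_le; last exact: is_cvg_binc.
apply: nondecreasing_series => k _ _.
by rewrite mulr_ge0 ?exprn_ge0 ?binc_ge0 // ltW.
Qed.

End BinomialSeriesSum.

(** * Uniqueness of power series coefficients; identification of the Cesaro numbers *)

Section CesaroNumbers.
Variable R : realType.
Implicit Types (z p : R).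

(** Convergence at 1/2 gives |D n| <= K 2^n. If all coefficients below m vanish, |D m| z^m is at
    most a partial sum, which tends to 0, plus a tail of order z^(m + 1); dividing by z^m and
    letting z tend to 0 gives D m = 0. *)
Lemma pseries_eq0 (D : R^nat) :
  (forall z, `|z| < 1 -> pseries D z @ \oo --> (0 : R)) -> forall n, D n = 0.
Proof.
move=> D0.
have h1 : `|2^-1 : R| < 1 by rewrite ger0_norm//; lra.
have [K K0 DK] : exists2 K, 0 < K & forall n, `|D n| <= K * 2 ^+ n.
  have cv : cvgn (pseries D 2^-1) by apply/cvg_ex; exists 0; exact: D0.
  have /cvg_seq_bounded := cvgP _ (cvg_series_cvg_0 cv).
  move=> /pinfty_ex_gt0[K K0 HK]; exists K => // n.
  have /= := HK n I; rewrite exprVn normrM normfV.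
  by rewrite [`|_ ^+ n|]ger0_norm ?exprn_ge0// ler_pdivrMr// exprn_gt0.
elim/ltn_ind => m IH.
suff H z : 0 < z <= 4^-1 -> `|D m| <= (4 * K * 2 ^+ m) * z.
  apply/eqP; rewrite -normr_le0; apply/ler_addgt0Pr => e e0; rewrite add0r.
  pose c := 4 * K * 2 ^+ m; have c0 : 0 < c by rewrite !mulr_gt0 ?exprn_gt0.
  pose z := Num.min (4^-1) (e / c).
  have z0 : 0 < z by rewrite lt_min divr_gt0// andbT; lra.
  apply: le_trans (H z _) _; first by rewrite z0 ge_min lexx.
  by rewrite mulrC -ler_pdivlMr// ge_min lexx orbT.
move=> /andP[z0 z4].
have zm0 : 0 < z ^+ m by rewrite exprn_gt0.
have tail N : `|\sum_(m.+1 <= n < N) D n * z ^+ n| <= 2 * K * (2 * z) ^+ m.+1.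
  apply: le_trans (ler_norm_sum _ _ _) _.
  apply: (@le_trans _ _ (\sum_(m.+1 <= n < N) K * (2 * z) ^+ n)).
    apply: ler_sum => n _; rewrite normrM [`|z ^+ n|]gtr0_norm ?exprn_gt0//.
    by rewrite exprMn mulrA ler_wpM2r// exprn_ge0// ltW.
  (* The ratio 2 z is at most 1/2, so twice the first term dominates the geometric sum; the
     subtracted power makes the bound inductive, and [maxn] covers empty ranges. *)
  have geo k : \sum_(m.+1 <= n < k) K * (2 * z) ^+ n <=
      2 * K * ((2 * z) ^+ m.+1 - (2 * z) ^+ (maxn k m.+1)).
    elim: k => [|k IHk]; first by rewrite big_geq// max0n subrr mulr0.
    have [km|mk] := leqP m.+1 k; last first.
      by rewrite big_geq// (maxn_idPr mk) subrr mulr0.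
    rewrite big_nat_recr//=; move: IHk.
    rewrite (maxn_idPl km) (maxn_idPl (leqW km)) => IHk.
    apply: le_trans (lerD IHk (lexx _)) _.
    rewrite (exprS _ k); set q := (2 * z) ^+ k; set q' := (2 * z) ^+ m.+1.
    have q0 : 0 <= q by rewrite exprn_ge0// mulr_ge0// ltW.
    have Kq : 0 <= K * q by rewrite mulr_ge0// ltW.
    rewrite -subr_ge0.
    have -> : 2 * K * (q' - 2 * z * q) - (2 * K * (q' - q) + K * q) =
      (1 - 4 * z) * (K * q) by ring.
    by rewrite mulr_ge0//; lra.
  apply: le_trans (geo N) _; rewrite ler_pM2l ?mulr_gt0// lerBlDr lerDl.
  by rewrite exprn_ge0// mulr_ge0// ltW.
have step N : (m < N)%N ->
    `|D m| * z ^+ m <= `|pseries D z N| + 2 * K * (2 * z) ^+ m.+1.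
  move=> mN.
  have -> : pseries D z N = D m * z ^+ m + \sum_(m.+1 <= n < N) D n * z ^+ n.
    rewrite /pseries /series /= (@big_cat_nat _ _ _ m)//=; last exact: ltnW.
    rewrite big_nat_cond big1 ?add0r; last first.
      by move=> i /andP[/andP[_ im] _]; rewrite IH// mul0r.
    by rewrite big_ltn.
  rewrite -{1}(gtr0_norm zm0) -normrM; set t := \sum_(_ <= _ < _) _.
  rewrite -{1}(addrK t (D m * z ^+ m)); apply: le_trans (ler_normB _ _) _.
  by rewrite lerD2l; exact: tail.
have : `|D m| * z ^+ m <= 2 * K * (2 * z) ^+ m.+1.
  apply/ler_addgt0Pr => e e0.
  have z1 : `|z| < 1 by rewrite gtr0_norm//; lra.
  have /cvgrPdist_le /(_ _ e0) [N _ HN] := D0 z z1.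
  have /= := HN (maxn N m.+1) (leq_maxl _ _); rewrite sub0r normrN => he.
  by apply: le_trans (step _ (leq_maxr N m.+1)) _; rewrite addrC lerD2l.
rewrite exprMn !exprS => h; rewrite -(ler_pM2r zm0); apply: le_trans h _.
by rewrite le_eqVlt; apply/orP; left; apply/eqP; ring.
Qed.

(** [cesaro_number] is a choice among the sequences with the prescribed sum: [cvg_binc] shows that
    there is one, and [pseries_eq0] that there is no other. *)
Lemma cesaro_numberE (a : R) : 0 < a -> cesaro_number (a - 1) = binc a.
Proof.
move=> a0.
have : [set A : nat -> R | forall z : R, `|z| < 1 ->
    series (fun n => A n * z ^+ n) @ \oo --> (1 - z) `^ (- (a - 1 + 1))]
    (cesaro_number (a - 1)).
  rewrite /cesaro_number; apply: getPex; exists (binc a) => z z1; rewrite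
    subrK; exact: cvg_binc.
rewrite /= subrK; set A := cesaro_number _ => HA.
apply/funext => n; apply/eqP; rewrite -subr_eq0; apply/eqP.
move: n; apply: (@pseries_eq0 (fun n => A n - binc a n)) => z z1.
have -> : pseries (fun n => A n - binc a n) z =
    series (fun n => A n * z ^+ n) \- pseries (binc a) z.
  apply/funext => k; rewrite /pseries /series /= -sumrB.
  by apply: eq_bigr => i _; rewrite mulrBl.
by rewrite -(subrr ((1 - z) `^ (- a))); apply: cvgB; [exact: HA|exact:
  cvg_binc].
Qed.

(* [x^p <= p^p e^x] for [x := n (1 - z)], whereas [z^n <= e^(-x)]. *)
Lemma powR_geometric_le p : 0 < p -> exists2 K, 0 < K &
  forall z n, 0 < z < 1 -> n%:R `^ p * z ^+ n <= K * (1 - z) `^ (- p).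
Proof.
move=> p0; exists (p `^ p) => [|z n /andP[z0 z1]]; first exact: powR_gt0.
have z1' : 0 < 1 - z by rewrite subr_gt0.
pose x := n%:R * (1 - z); have x0 : 0 <= x by rewrite mulr_ge0// ltW.
have nE : n%:R = x * (1 - z)^-1 :> R by rewrite /x mulfK// gt_eqF.
rewrite nE powRM ?invr_ge0 ?(ltW z1')// -powR_inv1 ?(ltW z1')// -powRrM mulN1r.
rewrite mulrAC ler_wpM2r ?powR_ge0//.
have zn : z ^+ n <= expR (- x).
  have -> : - x = (z - 1) * n%:R by rewrite /x; ring.
  rewrite expRM_natr lerXn2r ?nnegrE ?expR_ge0// ?(ltW z0)//.
  by have := expR_ge1Dx (z - 1); rewrite addrC subrK.
(* This is e^(x / p) >= x / p raised to the power p. *)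
have xp : x `^ p <= p `^ p * expR x.
  have xE : x = p * (x / p) by rewrite mulrC divfK// gt_eqF.
  have xp0 : 0 <= x / p by rewrite divr_ge0// ltW.
  rewrite {1}xE powRM ?(ltW p0)// ler_wpM2l ?powR_ge0//.
  have -> : expR x = expR (x / p) `^ p by rewrite -expRM divfK// gt_eqF.
  apply: ge0_ler_powR; rewrite ?nnegrE ?expR_ge0 ?(ltW p0)//.
  by apply: le_trans (expR_ge1Dx _); rewrite lerDr.
apply: le_trans (ler_pM _ _ xp zn) _; rewrite ?powR_ge0 ?exprn_ge0 ?(ltW z0)//.
by rewrite -mulrA -expRD subrr expR0 mulr1.
Qed.

End CesaroNumbers.

(** * The norm as a real number; roots of unity *)

Section RealNorm.
Variables (R : realType) (V : normedZmodType R[i]).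
Implicit Types (x y : V).

Definition nrm x : R := complex.Re `|x|.

Lemma nrmE x : `|x| = (nrm x)%:C.
Proof. by rewrite RRe_real. Qed.

Lemma nrm_ge0 x : 0 <= nrm x.
Proof. by rewrite -ler0c -nrmE. Qed.

Lemma nrm0 : nrm (0 : V) = 0.
Proof. by rewrite /nrm normr0. Qed.

Lemma nrm_eq0 x : (nrm x == 0) = (x == 0).
Proof. by rewrite -[x == 0]normr_eq0 nrmE -(inj_eq (@complexI R)). Qed.

Lemma nrmN x : nrm (- x) = nrm x.
Proof. by rewrite /nrm normrN. Qed.

Lemma nrm_sub x y : nrm (x - y) = nrm (y - x).
Proof. by rewrite -nrmN opprB. Qed.

Lemma nrmD x y : nrm (x + y) <= nrm x + nrm y.
Proof. by rewrite -lecR rmorphD /= -!nrmE ler_normD. Qed.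

Lemma nrmB x y : nrm (x - y) <= nrm x + nrm y.
Proof. by rewrite -(nrmN y) nrmD. Qed.

Lemma nrm_sum (I : Type) (s : seq I) (P : pred I) (F : I -> V) :
  nrm (\sum_(i <- s | P i) F i) <= \sum_(i <- s | P i) nrm (F i).
Proof.
elim/big_ind2 : _ => //; first by rewrite nrm0.
by move=> x1 x2 y1 y2 h1 h2; apply: le_trans (nrmD _ _) _; exact: lerD.
Qed.

End RealNorm.

Section ScalarNorm.
Variable R : realType.
Implicit Types (z : R[i]) (r : R).

Lemma nrmM z1 z2 : nrm (z1 * z2) = nrm z1 * nrm z2.
Proof. by apply: complexI; rewrite rmorphM /= -!nrmE normrM. Qed.

Lemma nrmX z n : nrm (z ^+ n) = nrm z ^+ n.
Proof. by apply: complexI; rewrite rmorphXn /= -!nrmE normrX. Qed.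

Lemma nrmV z : nrm z^-1 = (nrm z)^-1.
Proof. by apply: complexI; rewrite fmorphV /= -!nrmE normfV. Qed.

Lemma nrm1 : nrm (1 : R[i]) = 1.
Proof. by rewrite /nrm normr1. Qed.

Lemma nrm_real r : nrm r%:C = `|r|.
Proof. by rewrite /nrm normc_def /= expr0n addr0 sqrtr_sqr. Qed.

Lemma nrmZ (V : normedModType R[i]) z (x : V) : nrm (z *: x) = nrm z * nrm x.
Proof. by apply: complexI; rewrite rmorphM /= -!nrmE normrZ. Qed.

Lemma nrm_unit z : (`|z| == 1) = (nrm z == 1).
Proof. by rewrite nrmE -(inj_eq (@complexI R)). Qed.

Lemma le_nrm_ReIm z : nrm z <= `|complex.Re z| + `|complex.Im z|.
Proof.
rewrite /nrm normc_def /=.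
rewrite -(@ler_pXn2r _ 2) ?nnegrE ?sqrtr_ge0 ?addr_ge0// sqr_sqrtr; last first.
  by rewrite addr_ge0 ?sqr_ge0.
rewrite -[complex.Re z ^+ 2]real_normK ?num_real//.
rewrite -[complex.Im z ^+ 2]real_normK ?num_real//.
by rewrite sqrrD addrAC lerDl mulrn_wge0// mulr_ge0.
Qed.

Lemma normRe_le_nrm z : `|complex.Re z| <= nrm z.
Proof. by rewrite -lecR -nrmE normc_ge_Re. Qed.

Lemma normIm_le_nrm z : `|complex.Im z| <= nrm z.
Proof.
have := normRe_le_nrm (z * 'i%C); rewrite ReiNIm normrN nrmM.
by rewrite [nrm 'i%C]/nrm normc_def /= expr0n add0r expr1n sqrtr1 mulr1.
Qed.

End ScalarNorm.

Section RootsOfUnity.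
Variable R : realType.

(** X^N - 1 splits over the complex numbers and is separable in characteristic 0, so it has N
    distinct roots, and among N distinct N-th roots of unity one is primitive. *)
Lemma prim_root_exists N : (0 < N)%N -> exists w : R[i], N.-primitive_root w.
Proof.
move=> N0; pose p : {poly R[i]} := 'X^N - 1.
have [s Dp] := closed_field_poly_normal p.
rewrite (monicP _) ?monicXnsubC // scale1r in Dp.
have s1 : all N.-unity_root s by apply/allP=> z; rewrite -root_prod_XsubC -Dp.
have sz : (N < (size s).+1)%N.
  by rewrite -(size_prod_XsubC s id) -Dp size_XnsubC.
have [|w] := hasP (has_prim_root N0 s1 _ sz); last by exists w.
rewrite -separable_prod_XsubC -Dp separable_Xn_sub_1 //.
by rewrite pnatr_eq0 -lt0n.
Qed.

Variables (N : nat) (w : R[i]) (N0 : (0 < N)%N) (pw : N.-primitive_root w).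

Lemma prim_root_nrm : nrm w = 1.
Proof.
apply/eqP; rewrite -(@pexpr_eq1 _ _ N) ?nrm_ge0//.
by rewrite -nrmX (prim_expr_order pw) nrm1.
Qed.

Lemma prim_root_neq0 : w != 0.
Proof. by rewrite -nrm_eq0 prim_root_nrm oner_eq0. Qed.

(** The hypotheses say |a - b| < N, so w^(b - a) is 1 only for a = b; otherwise the geometric sum of
    an N-th root of unity other than 1 vanishes. *)
Lemma prim_root_orth a b : (a < b + N)%N -> (b < a + N)%N ->
  \sum_(k < N) (w ^+ k)^-1 ^+ a * (w ^+ k) ^+ b = (if a == b then N%:R else 0).
Proof.
move=> ab ba; pose u := w^-1 ^+ a * w ^+ b.
have uE (k : 'I_N) : (w ^+ k)^-1 ^+ a * (w ^+ k) ^+ b = u ^+ k.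
  by rewrite /u exprMn -exprVn !(exprAC _ k).
under eq_bigr do rewrite uE.
case: (eqVneq a b) => [eab|neq].
  rewrite (eq_bigr (fun=> 1)) ?sumr_const ?card_ord// => k _.
  by rewrite /u eab -exprMn mulVf ?prim_root_neq0// !expr1n.
have uN : u ^+ N = 1.
  by rewrite /u exprMn !(exprAC _ _ N) exprVn (prim_expr_order pw) invr1
    !expr1n mulr1.
have u1 : u != 1.
  apply/negP; rewrite /u exprVn => /eqP h.
  have {h} : w ^+ b = w ^+ a.
    rewrite -[LHS](mulVKf (expf_neq0 a prim_root_neq0)) h mulr1//.
  move/eqP; rewrite (eq_prim_root_expr pw) => /eqP h.
  move: neq; have [le|/ltnW le] := leqP a b.
    have : (N %| b - a)%N by rewrite -eqn_mod_dvd// h.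
    rewrite /dvdn modn_small ?subn_eq0; last by rewrite ltn_subLR.
    by move=> ba'; rewrite eqn_leq le ba'.
  have : (N %| a - b)%N by rewrite -eqn_mod_dvd// h.
  rewrite /dvdn modn_small ?subn_eq0; last by rewrite ltn_subLR.
  by move=> ab'; rewrite eqn_leq le ab'.
apply/eqP; have : (u - 1) * \sum_(k < N) u ^+ k = 0.
  by rewrite -subrX1 uN subrr.
by move/eqP; rewrite mulf_eq0 subr_eq0 (negPf u1).
Qed.

End RootsOfUnity.

(** * Decay of r^n T^n for r < 1 *)

Section Pencil.
Variables (R : realType) (X : completeNormedModType R[i]).

Lemma linear_nrm_bound (S : X -> X) : linear S -> continuous S ->
  exists2 M, 0 < M & forall x, nrm (S x) <= M * nrm x.
Proof.
move=> lS cS; pose m := GRing.isLinear.Build R[i] X X _ S lS.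
pose SL : {linear X -> X} := HB.pack S m.
have /linear_boundedP [M [Mr HM]] : bounded_near SL (nbhs (0 : X)).
  by apply: continuous_linear_bounded; exact: cS.
have M1 : M < (`|complex.Re M| + 1)%:C.
  rewrite -(RRe_real Mr) ltcR; apply: le_lt_trans (ler_norm _) _.
  by rewrite ltrDl.
exists (`|complex.Re M| + 1) => [|x]; first by rewrite ltr_wpDl.
by have := HM _ M1 x; rewrite !nrmE -rmorphM lecR.
Qed.

Variable T : {linear X -> X}.

Lemma iter_is_linear n : linear (iter n T).
Proof.
by elim: n => // n IH a x y; rewrite !iterS IH linearP.
Qed.

HB.instance Definition _ n :=
  GRing.isLinear.Build R[i] X X _ (iter n T) (iter_is_linear n).

Lemma geometric_sum_resolvent z J x (v := \sum_(j < J) z ^+ j *: iter j T x) :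
  v - z *: T v = x - z ^+ J *: iter J T x.
Proof.
rewrite {}/v; elim: J => [|J IH].
  by rewrite !big_ord0 linear0 scaler0 subr0 expr0 scale1r subrr.
rewrite big_ord_recr /= linearD scalerDr opprD addrACA IH.
by rewrite [T (_ *: _)]linearZ scalerA -exprS addrA subrK.
Qed.

Lemma iter_scale (l : R[i]) n x :
  iter n (fun x => l *: T x) x = l ^+ n *: iter n T x.
Proof.
elim: n => [|n IH]; first by rewrite expr0 scale1r.
by rewrite !iterS IH linearZ scalerA -exprS.
Qed.

Hypothesis hT : continuous T.
Hypothesis hsp : (spectrum T `<=` [set l : R[i] | `|l| <= 1])%classic.

(** For z nonzero, I - z T = z (z^-1 I - T), and z^-1 lies outside the closed disk, hence outside
    the spectrum. *)
Lemma pencil_inverse z : nrm z < 1 -> exists S : X -> X,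
  [/\ forall x, S (x - z *: T x) = x, forall x, S x - z *: T (S x) = x &
      exists2 M, 0 < M & forall x, nrm (S x) <= M * nrm x].
Proof.
move=> z1; have [->|z0] := eqVneq z 0.
  exists id; split=> [x|x|]; rewrite ?scale0r ?subr0//.
  by exists 1 => // x; rewrite mul1r.
have : ~ spectrum T z^-1.
  move=> /hsp /=; rewrite nrmE lecR nrmV leNgt invf_gt1 ?z1//.
  by rewrite lt_neqAle nrm_ge0 eq_sym nrm_eq0 z0.
rewrite /spectrum /= => /contrapT [S [lS cS S1 S2]].
pose m := GRing.isLinear.Build R[i] X X _ S lS.
pose SL : {linear X -> X} := HB.pack S m.
exists (fun x => z^-1 *: S x); split=> [x|x|].
- have -> : z^-1 *: S (x - z *: T x) = S (z^-1 *: (x - z *: T x)).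
    exact/esym/(linearZ_LR SL).
  by rewrite scalerBr scalerA mulVf// scale1r; exact: S1.
- by rewrite [T (_ *: _)]linearZ scalerA mulfV// scale1r; exact: S2.
- have [M M0 HM] := linear_nrm_bound lS cS.
  exists (nrm z^-1 * M) => [|x].
    by rewrite mulr_gt0// lt_neqAle nrm_ge0 eq_sym nrm_eq0 invr_eq0 z0.
  by rewrite nrmZ -mulrA ler_wpM2l ?nrm_ge0.
Qed.

(** Perturbation of the inverse at z0: for |z - z0| <= 1 / (2 M t) the term (z - z0) T u contributes
    at most half of |u|, which is absorbed on the left at the cost of doubling M. *)
Lemma pencil_bound_near z0 : nrm z0 < 1 ->
  exists2 e, 0 < e & exists2 M, 0 < M & forall z, nrm (z - z0) <= e ->
    forall u, nrm u <= M * nrm (u - z *: T u).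
Proof.
move=> z01; have [S [S1 _ [M M0 HM]]] := pencil_inverse z01.
have [t t0 Ht] := linear_nrm_bound (linearP T) hT.
exists (2 * M * t)^-1; first by rewrite invr_gt0 !mulr_gt0.
exists (2 * M) => [|z ze u]; first by rewrite mulr_gt0.
have : nrm u <= M * (nrm (u - z *: T u) + (2 * M * t)^-1 * (t * nrm u)).
  rewrite -{1}(S1 u); apply: le_trans (HM _) _; rewrite ler_pM2l//.
  have -> : u - z0 *: T u = (u - z *: T u) + (z - z0) *: T u.
    by rewrite scalerBl addrA subrK.
  apply: le_trans (nrmD _ _) _; rewrite lerD2l nrmZ.
  by apply: ler_pM; rewrite ?nrm_ge0.
have -> : (2 * M * t)^-1 * (t * nrm u) = (2 * M)^-1 * nrm u.
  by field; apply/andP; split; rewrite gt_eqF.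
rewrite mulrDr mulrA.
have -> : M / (2 * M) = 2^-1 by field; rewrite gt_eqF.
by lra.
Qed.

(** The local bounds are made uniform by compactness, in real coordinates, of the square [-1, 1]^2,
    which contains the disk of radius rho. *)
Lemma pencil_bound rho : rho < 1 ->
  exists2 M, 0 < M & forall z, nrm z <= rho ->
    forall u, nrm u <= M * nrm (u - z *: T u).
Proof.
move=> rho1.
pose K := (`[-1, 1]%classic : set R) `*` (`[-1, 1]%classic : set R).
have cK : compact K by apply: compact_setX; exact: segment_compact.
pose P (M : R) (ab : R * R) := nrm (ab.1 +i* ab.2) <= rho ->
  forall u, nrm u <= M * nrm (u - (ab.1 +i* ab.2) *: T u).
have cover (ab0 : R * R) : K ab0 ->
    \forall ab \near ab0 & M \near +oo, P M ab.
  case: ab0 => a0 b0 _; pose z0 := a0 +i* b0.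
  have close e (ab : R * R) : ball (a0, b0) e ab ->
      nrm ((ab.1 +i* ab.2) - z0) <= e + e.
    move=> [] /=; rewrite -!ball_normE /= => ha hb.
    apply: le_trans (le_nrm_ReIm _) _; rewrite /=.
    by rewrite distrC [X in _ + X]distrC; apply: lerD; exact: ltW.
  have [z01|z01] := ltP (nrm z0) 1.
    have [e e0 [M M0 HM]] := pencil_bound_near z01.
    exists (ball (a0, b0) (e / 2), [set M' | M <= M']) => /=.
      split; first by apply: nbhsx_ballx; rewrite divr_gt0.
      by apply: nbhs_pinfty_ge; rewrite num_real.
    move=> [ab M'] [/= hab MM'] _ u.
    apply: le_trans (HM (ab.1 +i* ab.2) _ u) _.
      by apply: le_trans (close _ _ hab) _; rewrite -splitr.
    by rewrite ler_wpM2r ?nrm_ge0.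
  (* Around a point of modulus at least 1 the claim is vacuous: coordinates within d move the
     modulus by at most 2 d < 1 - rho. *)
  pose d := (1 - rho) / 3; have d0 : 0 < d by rewrite divr_gt0 ?subr_gt0.
  exists (ball (a0, b0) d, setT) => /=.
    by split; [exact: nbhsx_ballx|exact: filterT].
  move=> [ab M'] [/= hab _] zr; exfalso.
  have := close _ _ hab; rewrite nrm_sub => h.
  have := nrmD (z0 - (ab.1 +i* ab.2)) (ab.1 +i* ab.2); rewrite subrK.
  by move: z01 zr h; rewrite /d /=; lra.
have /(_ _ _ P _ cover) := (compact_near_coveringP K).1 cK.
move=> /pinfty_ex_gt0 [M M0 HM]; exists M => // z zr u.
have /= := HM (complex.Re z, complex.Im z) _ _ u.
rewrite /=; case: z zr => a b /= zr; apply => //.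
have ha := le_trans (normRe_le_nrm (a +i* b)) (le_trans zr (ltW rho1)).
have hb := le_trans (normIm_le_nrm (a +i* b)) (le_trans zr (ltW rho1)).
by split; rewrite /= in_itv /= -ler_norml.
Qed.

End Pencil.

(** * Averages of the resolvent over roots of unity *)

Section ResolventAverage.
Variables (R : realType) (X : completeNormedModType R[i]).
Variables (T : {linear X -> X}) (S : R[i] -> X -> X).
Hypothesis S1 : forall z, nrm z < 1 -> forall x, S z (x - z *: T x) = x.
Hypothesis S2 : forall z, nrm z < 1 -> forall x, S z x - z *: T (S z x) = x.

Lemma geometric_sum_resolventC z J x :
  \sum_(j < J) z ^+ j *: iter j T (x - z *: T x) = x - z ^+ J *: iter J T x.
Proof.
rewrite -geometric_sum_resolvent linear_sum scaler_sumr -sumrB.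
apply: eq_bigr => j _; rewrite linearB /= scalerBr; congr (_ - _).
rewrite [iter j T (_ *: _)]linearZ [T (_ *: _)]linearZ /=.
by rewrite -iterSr -iterS !scalerA mulrC.
Qed.

Variables (N : nat) (w : R[i]).
Hypothesis pw : N.-primitive_root w.
Hypothesis N0 : (0 < N)%N.

Lemma nrm_scaled_root (r : R) k : 0 <= r -> nrm (r%:C * w ^+ k) = r.
Proof.
by move=> r0; rewrite nrmM nrmX (prim_root_nrm N0 pw) expr1n mulr1 nrm_real
  ger0_norm.
Qed.

Lemma scaled_rootN (r : R) k : (r%:C * w ^+ k) ^+ N = (r ^+ N)%:C.
Proof.
by rewrite exprMn exprAC (prim_expr_order pw) expr1n mulr1 rmorphXn.
Qed.

Lemma sum_scaled_root (r : R) (y : nat -> X) :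
  \sum_(k < N) \sum_(j < N) (r%:C * w ^+ k) ^+ j *: y j = N%:R *: y 0.
Proof.
rewrite exchange_big /=; case: N N0 pw => // n _ pwn.
rewrite big_ord_recl /= [X in _ + X]big1 ?addr0.
  by rewrite (eq_bigr (fun=> y 0)) ?sumr_const ?card_ord ?scaler_nat// => k _;
     rewrite expr0 scale1r.
move=> j _; rewrite -scaler_suml.
have -> : \sum_(k < n.+1) (r%:C * w ^+ k) ^+ lift ord0 j
    = r%:C ^+ lift ord0 j *
      \sum_(k < n.+1) (w ^+ k)^-1 ^+ 0 * (w ^+ k) ^+ lift ord0 j.
  by rewrite mulr_sumr; apply: eq_bigr => k _; rewrite exprMn expr0 mul1r.
by rewrite (prim_root_orth (ltn0Sn n) pwn) ?mulr0 ?scale0r ?addnS ?add0n.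
Qed.

(** The mean of 1 / (1 - r w^k t) over k is 1 / (1 - r^N t^N); accordingly this is the inverse of I
    - r^N T^N for 0 <= r < 1. *)
Definition resolvent_average (r : R) x :=
  N%:R^-1 *: \sum_(k < N) S (r%:C * w ^+ k) x.

Let N0' : N%:R != 0 :> R[i].
Proof. by rewrite pnatr_eq0 -lt0n. Qed.

Lemma resolvent_averageK (r : R) x : 0 <= r < 1 ->
  resolvent_average r (x - (r ^+ N)%:C *: iter N T x) = x.
Proof.
move=> /andP[r0 r1]; rewrite /resolvent_average.
(* For z = r w^k one has z^N = r^N, so I - r^N T^N factors as I - z T times a geometric sum, and S z
   cancels the first factor. *)
rewrite (eq_bigr (fun k : 'I_N =>
  \sum_(j < N) (r%:C * w ^+ k) ^+ j *: iter j T x)).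
  by rewrite (sum_scaled_root r (fun j => iter j T x)) scalerA mulVf// scale1r.
move=> k _; rewrite -(scaled_rootN r k) -geometric_sum_resolvent S1//.
by rewrite nrm_scaled_root.
Qed.

Lemma resolvent_averageKV (r : R) x : 0 <= r < 1 ->
  resolvent_average r x - (r ^+ N)%:C *: iter N T (resolvent_average r x) = x.
Proof.
move=> /andP[r0 r1]; rewrite /resolvent_average.
rewrite [iter N T (_ *: _)]linearZ /= scalerA mulrC -scalerA -scalerBr
  linear_sum scaler_sumr -sumrB.
rewrite (eq_bigr (fun k : 'I_N =>
  \sum_(j < N) (r%:C * w ^+ k) ^+ j *: iter j T x)).
  by rewrite (sum_scaled_root r (fun j => iter j T x)) scalerA mulVf// scale1r.
move=> k _; rewrite -(scaled_rootN r k) -geometric_sum_resolventC.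
by apply: eq_bigr => j _; rewrite S2// nrm_scaled_root.
Qed.

Variables (M t rho : R).
Hypothesis rho1 : rho < 1.
Hypothesis M0 : 0 < M.
Hypothesis HM : forall z, nrm z <= rho ->
    forall u, nrm u <= M * nrm (u - z *: T u).
Hypothesis t0 : 0 < t.
Hypothesis Ht : forall x, nrm (T x) <= t * nrm x.

(** The resolvent identity at each root: the difference of the two inverses is (zs - zr) times
    inverse, T, inverse, and |zs - zr| = |s - r|. The factors are bounded by M, t and M whatever N
    is. *)
Lemma resolvent_average_lipschitz (r s : R) x : 0 <= r <= rho -> 0 <= s <= rho
  ->
  nrm (resolvent_average s x - resolvent_average r x)
    <= `|s - r| * (M * t * M) * nrm x.
Proof.
move=> /andP[r0 rr] /andP[s0 sr].
rewrite /resolvent_average -scalerBr -sumrB nrmZ nrmV.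
have -> : nrm (N%:R : R[i]) = N%:R.
  by rewrite -(rmorph_nat (real_complex R)) /= nrm_real ger0_norm.
rewrite ler_pdivrMl ?ltr0n//; apply: le_trans (nrm_sum _ _ _) _.
rewrite mulr_natl -[X in _ *+ X]card_ord -sumr_const; apply: ler_sum => k _.
set zs := s%:C * _; set zr := r%:C * _.
have nzs : nrm zs = s by exact: nrm_scaled_root.
have nzr : nrm zr = r by exact: nrm_scaled_root.
apply: le_trans (HM (z := zs) _ _) _; first by rewrite nzs.
have e1 : S zs x - zs *: T (S zs x) = x.
  by apply: S2; rewrite nzs (le_lt_trans sr).
have e2 : S zr x - zr *: T (S zr x) = x.
  by apply: S2; rewrite nzr (le_lt_trans rr).
have -> : S zs x - S zr x - zs *: T (S zs x - S zr x) = (zs - zr) *: T (S zr x).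
  rewrite linearB scalerBr opprB [zs *: T (S zr x) - _]addrC addrACA e1 -{1}e2.
  by rewrite addrACA subrr add0r scalerBl addrC.
have -> : zs - zr = (s - r)%:C * w ^+ k by rewrite rmorphB mulrBl.
have wk : nrm (w ^+ k) = 1 by rewrite nrmX (prim_root_nrm N0 pw) expr1n.
rewrite nrmZ nrmM wk nrm_real mulr1 mulrCA -!mulrA ler_wpM2l//.
rewrite ler_pM2l// (le_trans (Ht _))// ler_pM2l// -{2}e2.
by apply: HM; rewrite nzr.
Qed.

End ResolventAverage.

(** * Continuation of the decay in the radius *)

Section PowerDecayTheorem.
Variables (R : realType) (X : completeNormedModType R[i]).
Variable (T : {linear X -> X}).

(** J0 is chosen before x: this is decay in operator norm, expressed without the extended-real
    [opnorm]. *)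
Definition power_decay (r : R) : Prop := forall e, 0 < e ->
  exists J0, forall J, (J0 <= J)%N -> forall x,
    r ^+ J * nrm (iter J T x) <= e * nrm x.

Lemma power_decay_of_bounded (r s : R) J0 : 0 <= r -> r < s ->
  (forall J, (J0 <= J)%N -> forall x, s ^+ J * nrm (iter J T x) <= nrm x) ->
  power_decay r.
Proof.
move=> r0 rs H e e0; have s0 : 0 < s by exact: le_lt_trans rs.
have q1 : `|r / s| < 1.
  by rewrite ger0_norm ?divr_ge0 ?(ltW s0)// ltr_pdivrMr// mul1r.
have /cvgrPdist_le /(_ _ e0) [J1 _ HJ1] := cvg_expr q1.
exists (maxn J0 J1) => J; rewrite geq_max => /andP[JJ0 JJ1] x.
have -> : r ^+ J = (r / s) ^+ J * s ^+ J.
  by rewrite -exprMn divfK// gt_eqF.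
rewrite -mulrA; apply: ler_pM; rewrite ?mulr_ge0 ?exprn_ge0 ?divr_ge0 ?nrm_ge0
  ?(ltW s0)//.
  have := HJ1 J JJ1; rewrite sub0r normrN; apply: le_trans; exact: ler_norm.
exact: H.
Qed.

Hypothesis hT : continuous T.
Hypothesis hsp : (spectrum T `<=` [set l : R[i] | `|l| <= 1])%classic.

(* Rickart's argument: the averages of the resolvent over the N-th roots of
   unity invert I - r^N T^N and are Lipschitz in r uniformly in N, so that the
   decay of r^N T^N propagates to a slightly larger radius. *)
Lemma power_decay_lt1 (r : R) : 0 <= r < 1 -> power_decay r.
Proof.
move=> /andP[r0 r1].
pose rho := (1 + r) / 2.
have rho1 : rho < 1 by rewrite /rho; lra.
have rrho : r < rho by rewrite /rho; lra.
have [M M0 HM] := pencil_bound hT hsp rho1.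
have [t t0 Ht] := linear_nrm_bound (linearP T) hT.
have /choice [S HS] : forall z, exists S : X -> X, nrm z < 1 ->
    (forall x, S (x - z *: T x) = x) /\ (forall x, S x - z *: T (S x) = x).
  move=> z; have [z1|z1] := ltP (nrm z) 1; last by exists id.
  by have [S [? ? _]] := pencil_inverse hsp z1; exists S.
have S1 z z1 := (HS z z1).1; have S2 z z1 := (HS z z1).2.
pose L := M * t * M; have L0 : 0 < L by rewrite !mulr_gt0.
have step s s' : 0 <= s <= rho -> s <= s' <= rho -> (s' - s) * L <= 4^-1 ->
    power_decay s -> exists J0, forall J, (J0 <= J)%N ->
      forall x, s' ^+ J * nrm (iter J T x) <= nrm x.
  move=> /andP[s0 sr] /andP[ss' s'r] sL ds.
  have [J0 HJ0] := ds 8^-1 (ltac:(by rewrite invr_gt0)).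
  exists (maxn J0 1) => N; rewrite geq_max => /andP[NJ0 N0] u.
  have [w pw] := prim_root_exists R N0.
  have s's : 0 <= s' < 1 by apply/andP; split; [exact: le_trans ss'|exact:
    le_lt_trans rho1].
  have ss1 : 0 <= s < 1 by rewrite s0 (le_lt_trans sr).
  (* Both u and x are averages of this y, at the radii s' and s. From |u - x| <= |y| / 4 and |x - y|
     <= |x| / 8 follows |u - y| <= (11/28) |y|, and then |u - y| <= |u|, where u - y = s'^N T^N
     u. *)
  pose y := u - (s' ^+ N)%:C *: iter N T u.
  have uE : resolvent_average S N w s' y = u.
    exact: (resolvent_averageK S1 pw N0).
  pose x := resolvent_average S N w s y.
  have xE : x - (s ^+ N)%:C *: iter N T x = y.
    exact: (resolvent_averageKV S2 pw N0).
  have h1 : nrm (u - x) <= 4^-1 * nrm y.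
    rewrite -uE; apply: le_trans (resolvent_average_lipschitz S2 pw N0 rho1 M0
      HM t0 Ht _ _ _) _.
    - by rewrite s0.
    - by rewrite s'r andbT; case/andP: s's.
    - by rewrite ler_wpM2r ?nrm_ge0// ger0_norm// subr_ge0.
  have h2 : nrm (x - y) <= 8^-1 * nrm x.
    have -> : x - y = (s ^+ N)%:C *: iter N T x by rewrite -xE opprB addrC
      subrK.
    by rewrite nrmZ nrm_real ger0_norm ?exprn_ge0//; exact: HJ0.
  have h3 : nrm (u - y) = s' ^+ N * nrm (iter N T u).
    rewrite /y opprB addrC subrK nrmZ nrm_real ger0_norm// exprn_ge0//.
    by case/andP: s's.
  rewrite -h3.
  have t1 : nrm (u - y) <= nrm (u - x) + nrm (x - y).
    by have := nrmD (u - x) (x - y); rewrite addrA subrK.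
  have t2 : nrm x <= nrm (x - y) + nrm y.
    by have := nrmD (x - y) y; rewrite subrK.
  have t3 : nrm y <= nrm (u - y) + nrm u.
    by have := nrmD (y - u) u; rewrite subrK (nrm_sub y u).
  have u0 := nrm_ge0 u; lra.
pose d := (4 * L)^-1; have d0 : 0 < d by rewrite invr_gt0 mulr_gt0.
have dL : d * L = 4^-1 by rewrite /d; field; rewrite gt_eqF.
(* The radius advances by d / 2 although [step] allows d: the spare part gives boundedness at some
   s' > s1, which [power_decay_of_bounded] turns into decay at s1. The other bound rho - r keeps s'
   within rho. *)
have H n : power_decay (Num.min (n%:R * (d / 2)) r).
  elim: n => [|n IH].
    rewrite mul0r min_l// => e e0; exists 1%N => -[//|J] _ x.
    by rewrite exprS !mul0r mulr_ge0 ?nrm_ge0 ?ltW.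
  set s := Num.min _ _ in IH; set s1 := Num.min _ _.
  pose s' := s1 + Num.min (d / 2) (rho - r).
  have m0 : 0 < Num.min (d / 2) (rho - r) by rewrite lt_min divr_gt0// subr_gt0.
  have s0 : 0 <= s by rewrite le_min r0 andbT mulr_ge0// divr_ge0// ltW.
  have sr : s <= r by rewrite ge_min lexx orbT.
  have s1r : s1 <= r by rewrite ge_min lexx orbT.
  have ss1 : s <= s1.
    rewrite le_min sr andbT (@le_trans _ _ (n%:R * (d / 2)))// ?ge_min ?lexx//.
    by rewrite ler_wpM2r ?ler_nat// divr_ge0// ltW.
  have s1s : s1 <= s + d / 2.
    rewrite /s /s1 -natr1 mulrDl mul1r; case: (leP (n%:R * (d / 2)) r) => h.
      by rewrite ge_min lexx.
    by rewrite ge_min (_ : r <= r + d / 2) ?orbT// lerDl divr_ge0// ltW.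
  have md : Num.min (d / 2) (rho - r) <= d / 2 by rewrite ge_min lexx.
  have mr : Num.min (d / 2) (rho - r) <= rho - r by rewrite ge_min lexx orbT.
  have [||| J0 HJ0] := step s s' _ _ _ IH.
  - by apply/andP; split=> //; lra.
  - by apply/andP; split; rewrite /s'; lra.
  - by rewrite -dL ler_pM2r// /s'; lra.
  apply: (power_decay_of_bounded _ _ HJ0); first exact: le_trans ss1.
  by rewrite /s' ltrDl.
pose n := Num.bound (r / (d / 2)).
have := H n; rewrite min_r//.
rewrite -ler_pdivrMr ?divr_gt0//; apply/ltW/archi_boundP.
by rewrite divr_ge0// divr_ge0// ltW.
Qed.

End PowerDecayTheorem.

(** * From the Kreiss condition to the Cesaro bounds *)

Section RootAverages.
Variables (R : realType) (N : nat) (w : R[i]).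
Hypothesis N0 : (0 < N)%N.
Hypothesis pw : N.-primitive_root w.

Lemma conjc_root k : ((w ^+ k)^*)%C = (w ^+ k)^-1.
Proof.
rewrite invc_norm nrmE nrmX (prim_root_nrm N0 pw) expr1n.
by rewrite -exprVn invr1 expr1n mul1r.
Qed.

(** The conjugate of w^k is its inverse, so orthogonality applies to the expanded square; L <= N
    keeps distinct indices incongruent modulo N. *)
Lemma parseval (a : nat -> R) L : (L <= N)%N ->
  \sum_(k < N) nrm (\sum_(i < L) (a i)%:C * (w ^+ k) ^+ i) ^+ 2
    = N%:R * \sum_(i < L) a i ^+ 2.
Proof.
move=> LN; apply: complexI; rewrite rmorphM rmorph_nat !rmorph_sum /=.
transitivity (\sum_(k < N) \sum_(i < L) \sum_(j < L)
    ((a i)%:C * (a j)%:C) * ((w ^+ k)^-1 ^+ j * (w ^+ k) ^+ i)).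
  apply: eq_bigr => k _; rewrite rmorphXn /= -nrmE sqr_normc rmorph_sum /=.
  rewrite mulr_suml; apply: eq_bigr => i _; rewrite mulr_sumr.
  apply: eq_bigr => j _; rewrite rmorphM rmorphXn /= conjc_root oppr0 (_ : a j
    +i* 0 = (a j)%:C)//.
  by ring.
rewrite exchange_big mulr_sumr; apply: eq_bigr => i _ /=.
rewrite exchange_big (bigD1 i) //= [X in _ + X]big1 ?addr0.
  rewrite -mulr_sumr (prim_root_orth N0 pw); last 2 first.
  - by rewrite -[X in (X < _)%N]addn0 ltn_add2l.
  - by rewrite -[X in (X < _)%N]addn0 ltn_add2l.
  by rewrite eqxx mulrC rmorphXn expr2.
move=> j ji; rewrite -mulr_sumr (prim_root_orth N0 pw).
- by rewrite (negPf ji : (j == i :> nat) = false) mulr0.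
- by rewrite ltn_addl// (leq_trans _ LN).
- by rewrite ltn_addl// (leq_trans _ LN).
Qed.

(** A discrete Cauchy formula for the n-th coefficient of a product. The size condition keeps every
    exponent m + j below n + N, so that congruence to n modulo N means equality. *)
Lemma convolution_average (V : lmodType R[i]) (r : R) (d : nat -> R[i])
    (y : nat -> V) D n J : (n < J)%N -> (n < D)%N -> (D + J <= n + N)%N ->
  \sum_(k < N) (w ^+ k)^-1 ^+ n *:
     ((\sum_(m < D) d m * (r%:C * w ^+ k) ^+ m) *:
        \sum_(j < J) (r%:C * w ^+ k) ^+ j *: y j)
  = (N%:R * r%:C ^+ n) *: \sum_(j < n.+1) d (n - j)%N *: y j.
Proof.
move=> nJ nD DJ.
transitivity (\sum_(j < J) (\sum_(m < D) (d m * r%:C ^+ (m + j)) *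
    \sum_(k < N) (w ^+ k)^-1 ^+ n * (w ^+ k) ^+ (m + j)) *: y j).
  transitivity (\sum_(k < N) \sum_(j < J) \sum_(m < D) ((d m * r%:C ^+ (m + j))
    *
     ((w ^+ k)^-1 ^+ n * (w ^+ k) ^+ (m + j))) *: y j).
    apply: eq_bigr => k _; rewrite scalerA scaler_sumr; apply: eq_bigr => j _.
    rewrite scalerA -scaler_suml mulr_sumr mulr_suml; congr (_ *: _).
    by apply: eq_bigr => m _; rewrite !exprD !exprMn; ring.
  rewrite exchange_big; apply: eq_bigr => j _ /=.
  rewrite exchange_big scaler_suml; apply: eq_bigr => m _ /=.
  by rewrite -scaler_suml -mulr_sumr.
have orth (j : 'I_J) : \sum_(m < D) (d m * r%:C ^+ (m + j)) *
    (\sum_(k < N) (w ^+ k)^-1 ^+ n * (w ^+ k) ^+ (m + j))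
    = if (j < n.+1)%N then N%:R * r%:C ^+ n * d (n - j)%N else 0.
  have E (m : 'I_D) : \sum_(k < N) (w ^+ k)^-1 ^+ n * (w ^+ k) ^+ (m + j)
      = if n == (m + j)%N then N%:R else 0.
    have mD := ltn_ord m; have jJ := ltn_ord j.
    by apply: (prim_root_orth N0 pw); lia.
  under eq_bigr do rewrite E.
  case: ifP => jn; last first.
    rewrite big1 // => m _; rewrite (_ : (_ == _) = false) ?mulr0//.
    by apply/eqP; lia.
  have hm : (n - j < D)%N by rewrite (leq_ltn_trans (leq_subr _ _)).
  rewrite (bigD1 (Ordinal hm)) //= subnK// eqxx big1 ?addr0.
    by ring.
  move=> m /eqP mn; rewrite (_ : (_ == _) = false) ?mulr0//.
  by apply/eqP => h; apply: mn; apply: val_inj => /=; rewrite h addnK.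
under eq_bigr do rewrite orth.
rewrite scaler_sumr (big_ord_widen J (fun j => (N%:R * r%:C ^+ n) *: (d (n -
  j)%N *: y j))) //.
rewrite [RHS]big_mkcond; apply: eq_bigr => j _ /=.
by case: ifP => _; rewrite ?scale0r// scalerA.
Qed.

End RootAverages.

(** * Coefficient bound from the mean square of h *)

Section AveragedBound.
Variables (R : realType) (X : completeNormedModType R[i]).
Variables (T : {linear X -> X}) (r M : R).
Hypothesis r0 : 0 < r.
Hypothesis M0 : 0 < M.
Hypothesis HM : forall z, nrm z = r -> forall u, nrm u <= M * nrm (u - z *: T
  u).
Hypothesis Tdecay : power_decay T r.

(* The n-th coefficient of h(z)^2 (I - z l T)^-1, with h the polynomial of
   coefficients b, is averaged over the circle of radius r; the mean of |h|^2
   is given by Parseval. *)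
Lemma nrm_convolution_le (b : nat -> R) n (l : R[i]) x : nrm l = 1 ->
  nrm (\sum_(j < n.+1) (\sum_(i < (n - j).+1) b i * b (n - j - i)%N)%:C *:
         (l ^+ j *: iter j T x))
    <= r ^- n * (\sum_(i < n.+1) (b i * r ^+ i) ^+ 2) * M * nrm x.
Proof.
move=> l1.
pose A : R := \sum_(i < n.+1) (b i * r ^+ i) ^+ 2; rewrite -/A.
have A0 : 0 <= A by apply: sumr_ge0 => i _; exact: sqr_ge0.
set s := \sum_(j < n.+1) _.
suff H e : 0 < e -> nrm s <= r ^- n * A * M * (nrm x + e * nrm x).
  have C0 : 0 <= r ^- n * A * M * nrm x.
    by rewrite !mulr_ge0 ?nrm_ge0 ?invr_ge0 ?exprn_ge0 ?(ltW r0) ?(ltW M0).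
  apply/ler_addgt0Pr => e e0.
  set C := r ^- n * A * M * nrm x in C0 *.
  (* Dividing by C + 1 instead of C covers C = 0. *)
  have C1 : 0 < C + 1 by rewrite ltr_wpDl.
  apply: le_trans (H (e / (C + 1)) _) _; first by rewrite divr_gt0.
  rewrite -[X in nrm x + X]mulrC -{1}[nrm x]mulr1 -mulrDr mulrA -/C mulrDr
    mulr1.
  rewrite lerD2l mulrCA ler_piMr ?ltW// ltr_pdivrMr// mul1r ltrDl//.
move=> e0; have [J0 HJ0] := Tdecay e0.
(* J > n retains all the terms needed. The square of h has 2 n + 1 coefficients, and N is the least
   value with (2 n + 1) + J <= n + N. *)
pose J := maxn J0 n.+1; pose N := (J + n.+1)%N.
have nJ : (n < J)%N by rewrite leq_maxr.
have N0 : (0 < N)%N by rewrite /N addnS.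
have [w pw] := prim_root_exists R N0.
(* Truncating at degree n leaves the coefficients of the square up to index n unchanged, and only
   these occur in [s]. *)
pose p : {poly R[i]} := \poly_(i < n.+1) (b i)%:C.
pose v k := \sum_(j < J) (r%:C * w ^+ k) ^+ j *: (l ^+ j *: iter j T x).
pose h k := \sum_(i < n.+1) (b i * r ^+ i)%:C * (w ^+ k) ^+ i.
have sp : (size (p * p)%R <= n.*2.+1)%N.
  apply: leq_trans (size_polyMleq _ _) _.
  have : (size p <= n.+1)%N by exact: size_poly.
  by move: (size p) => q; lia.
have hE k : h k ^+ 2 = \sum_(m < n.*2.+1) (p * p)`_m * (r%:C * w ^+ k) ^+ m.
  rewrite -(horner_coef_wide _ sp) hornerM -expr2; congr (_ ^+ 2).
  rewrite (horner_coef_wide _ (size_poly _ _)); apply: eq_bigr => i _.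
  by rewrite coef_poly ltn_ord rmorphM rmorphXn exprMn /= mulrA.
have := @convolution_average R N w N0 pw X r (fun m => (p * p)`_m)
  (fun j => l ^+ j *: iter j T x) n.*2.+1 n J nJ _ _.
move=> /(_ _ _) E.
have {}E : (N%:R * r%:C ^+ n) *: s =
    \sum_(k < N) (w ^+ k)^-1 ^+ n *: (h k ^+ 2 *: v k).
  under eq_bigr do rewrite hE.
  rewrite E; [|by rewrite ltnS -addnn leq_addr|by rewrite /N -addnn; lia].
  congr (_ *: _); apply: eq_bigr => j _; congr (_ *: _).
  rewrite coefM rmorph_sum; apply: eq_bigr => i _.
  rewrite !coef_poly rmorphM /=.
  have jn := ltn_ord j; have ij := ltn_ord i.
  by rewrite !ifT //; lia.
(* [v k] is a truncated Neumann series at z = r w^k l, of modulus r: I - z T maps it to x - z^J T^J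
   x, whose last term is at most e |x| by decay. *)
have vk (k : nat) : nrm (v k) <= M * (nrm x + e * nrm x).
  have zl : nrm ((r%:C * w ^+ k) * l) = r.
    by rewrite nrmM l1 mulr1 (nrm_scaled_root pw N0 _ (ltW r0)).
  have vE : v k = \sum_(j < J) ((r%:C * w ^+ k) * l) ^+ j *: iter j T x.
    by apply: eq_bigr => j _; rewrite scalerA -exprMn.
  apply: le_trans (HM zl _) _; rewrite ler_pM2l// vE geometric_sum_resolvent.
  apply: le_trans (nrmB _ _) _; rewrite lerD2l nrmZ nrmX zl.
  by apply: HJ0; rewrite leq_maxl.
have Nr : 0 < N%:R * r ^+ n by rewrite mulr_gt0 ?ltr0n ?exprn_gt0.
rewrite -(ler_pM2l Nr).
have <- : nrm ((N%:R * r%:C ^+ n) *: s) = N%:R * r ^+ n * nrm s.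
  rewrite nrmZ -rmorphXn -(rmorph_nat (real_complex R)) -rmorphM nrm_real.
  by rewrite gtr0_norm.
rewrite E; apply: le_trans (nrm_sum _ _ _) _.
apply: (@le_trans _ _ (\sum_(k < N) nrm (h k) ^+ 2 * (M * (nrm x + e * nrm
  x)))).
  apply: ler_sum => k _; rewrite !nrmZ !nrmX nrmV nrmX (prim_root_nrm N0 pw).
  by rewrite expr1n invr1 expr1n mul1r ler_wpM2l ?sqr_ge0.
rewrite -mulr_suml (parseval N0 pw (fun i => b i * r ^+ i)); last first.
  by rewrite /N leq_addl.
rewrite -/A le_eqVlt; apply/orP; left; apply/eqP.
by field; rewrite gt_eqF// exprn_gt0.
Qed.

End AveragedBound.

(** * Operator norms, uniform constants and the choice of radius *)

Section KreissToCesaro.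
Variables (R : realType) (X : completeNormedModType R[i]).

Lemma opnorm_le (S : X -> X) (C : R) : 0 <= C ->
  (forall x, nrm (S x) <= C * nrm x) -> (opnorm S <= C%:E)%E.
Proof.
move=> C0 H; apply: ge_ereal_sup => _ [x /= x1 <-]; rewrite lee_fin.
apply: le_trans (H x) _; rewrite ler_piMr//.
by move: x1; rewrite nrmE (_ : 1 = (1 : R)%:C)// lecR.
Qed.

Lemma nrm_le_opnorm (S : X -> X) (C : R) : scalable S ->
  (opnorm S <= C%:E)%E -> forall x, nrm (S x) <= C * nrm x.
Proof.
move=> sS H x; have [->|x0] := eqVneq x 0.
  by rewrite -{1}(scale0r 0) sS scale0r nrm0 mulr0.
have nx : 0 < nrm x by rewrite lt_neqAle nrm_ge0 eq_sym nrm_eq0 x0.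
pose y := ((nrm x)^-1)%:C *: x.
have ny : nrm y = 1.
  by rewrite nrmZ nrm_real gtr0_norm ?invr_gt0// mulVf// gt_eqF.
have : ((nrm (S y))%:E <= C%:E)%E.
  apply: le_trans H; apply: ereal_sup_ubound; exists y => //=.
  by rewrite nrmE ny.
rewrite lee_fin sS nrmZ nrm_real gtr0_norm ?invr_gt0//.
by rewrite ler_pdivrMl// mulrC.
Qed.

Variable T : {linear X -> X}.

Lemma cesaro_sum_scaleE (g : R) (l : R[i]) n x : 0 < g ->
  cesaro_sum g (fun x => l *: T x) n x
  = \sum_(j < n.+1) (binc g (n - j))%:C *: (l ^+ j *: iter j T x).
Proof.
move=> g0; rewrite /cesaro_sum cesaro_numberE//.
by apply: eq_bigr => j _; rewrite iter_scale.
Qed.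

Lemma cesaro_sum_is_linear (g : R) (l : R[i]) n :
  linear (cesaro_sum g (fun x => l *: T x) n).
Proof.
move=> a x y; rewrite /cesaro_sum scaler_sumr -big_split /=.
apply: eq_bigr => j _; rewrite !iter_scale.
by rewrite linearP !scalerDr !scalerA; congr (_ *: _ + _); ring.
Qed.

(** A real strictly above the supremum exceeds, for each l, some admissible bound, and admissible
    bounds may be enlarged; so one constant serves all l. *)
Lemma uniformly_cesaro_boundedP (g beta : R) :
  uniformly_cesaro_bounded g beta T <-> exists C : R,
    forall l : R[i], nrm l = 1 -> cesaro_bound g beta (fun x => l *: T x) C.
Proof.
rewrite /uniformly_cesaro_bounded; split=> [H|[C HC]].
  set s := ereal_sup _ in H.
  have [C HC] : exists C : R, (s < C%:E)%E.
    by case: s H => [r _||] //; [exists (r + 1); rewrite lte_fin ltrDl|exists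
      0; rewrite ltNyr].
  exists C => l l1.
  have : (cesaro_const g beta (fun x => l *: T x) < C%:E)%E.
    apply: le_lt_trans HC; apply: ereal_sup_ubound; exists l => //=.
    by apply/eqP; rewrite nrm_unit l1.
  move=> /ereal_inf_lt [_ [C' [C'0 HC'] <-]]; rewrite lte_fin => C'C.
  split=> [|n n0]; first exact: lt_trans C'C.
  apply: le_trans (HC' n n0) _; rewrite lee_fin ler_wpM2r ?powR_ge0//.
  exact: ltW.
apply: (@le_lt_trans _ _ C%:E); last exact: ltry.
apply: ge_ereal_sup => _ [l /= l1 <-].
have {}l1 : nrm l = 1 by apply/eqP; rewrite -nrm_unit l1.
by apply: ereal_inf_lbound; exists C => //; exact: HC.
Qed.

(** The Kreiss condition at z^-1, using I - z T = z (z^-1 I - T); the lower bound 1/2 on |z| places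
    z^-1 in the annulus of the definition. *)
Lemma kreiss_pencil (beta : R) : kreiss_bounded beta T ->
  exists2 C : R, 0 < C & forall z, 2^-1 < nrm z < 1 -> forall u,
    nrm u <= C / ((nrm z)^-1 - 1) `^ beta * ((nrm z)^-1 * nrm (u - z *: T u)).
Proof.
move=> [hsp [C [C0 HC]]]; exists C => // z /andP[z2 z1] u.
have nz : 0 < nrm z by rewrite (lt_trans _ z2)// invr_gt0.
have z0 : z != 0 by rewrite -nrm_eq0 gt_eqF.
have : ~ spectrum T z^-1.
  by move=> /hsp /=; rewrite nrmE lecR nrmV leNgt invf_gt1// z1.
rewrite /spectrum /= => /contrapT /getPex; rewrite -/(resolvent z^-1 T).
case=> lS _ S1 _.
have z1' : 1 < `|z^-1| < 2.
  have e2 : 2 = (2 : R)%:C :> R[i] by rewrite rmorph_nat.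
  rewrite nrmE e2 (_ : 1 = (1 : R)%:C :> R[i])// !ltcR nrmV invf_gt1// z1.
  by rewrite invf_plt ?posrE.
have := HC _ z1'; rewrite -/(nrm z^-1) nrmV => hop.
pose m := GRing.isLinear.Build R[i] X X _ (resolvent z^-1 T) lS.
pose SL : {linear X -> X} := HB.pack (resolvent z^-1 T) m.
have := nrm_le_opnorm (linearZ_LR SL) hop (z^-1 *: (u - z *: T u)).
rewrite nrmZ nrmV; congr (_ <= _); congr (nrm _).
rewrite -[RHS]S1; congr resolvent.
by rewrite scalerBr scalerA mulVf// scale1r.
Qed.

Lemma kreiss_cesaro (beta g : R) : continuous T -> 1 <= beta -> 1 < g ->
  kreiss_bounded beta T -> uniformly_cesaro_bounded g beta T.
Proof.
move=> hT b1 g1 kT; apply/uniformly_cesaro_boundedP.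
have hsp := kT.1; have [C C0 HC] := kreiss_pencil kT.
(* The hypothesis g > 1 enters here: squared coefficients of exponent g / 2 are compared with those
   of the positive exponent g - 1. *)
have a2 : 2^-1 < g / 2 by lra.
have [K K0 HK] := binc_sqr_le a2.
have gE : 2 * (g / 2) - 1 = g - 1 by field.
have g0 : 0 < g by lra.
(* The factors come from r^(-n) <= e, from [binc_sqr_le], from the resolvent with 1 / r <= 2, and
   from n + 1 <= n + 2 <= 3 n. *)
exists (expR 1 * K * (2 * C) * 3 `^ (g + beta - 1)) => l l1; split.
  by rewrite !mulr_gt0 ?expR_gt0 ?powR_gt0.
move=> n n0; have n1 : 1 <= n%:R :> R by rewrite ler1n.
apply: opnorm_le => [|x].
  by rewrite !mulr_ge0 ?expR_ge0 ?powR_ge0 ?(ltW K0) ?(ltW C0).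
rewrite cesaro_sum_scaleE//.
(* This radius makes 1 / r - 1 and 1 - r exactly 1 / (n + 1) and 1 / (n + 2), and it exceeds 1/2 as
   [kreiss_pencil] requires. *)
pose r : R := (n%:R + 1) / (n%:R + 2).
have r0 : 0 < r by rewrite divr_gt0//; lra.
have r1 : r < 1 by rewrite ltr_pdivrMr; lra.
have r2 : 2^-1 < r by rewrite ltr_pdivlMr; lra.
have rV : r^-1 - 1 = (n%:R + 1)^-1 by rewrite /r; field; apply/andP; split; lra.
have r1V : 1 - r = (n%:R + 2)^-1 by rewrite /r; field; lra.
pose M : R := 2 * C * (n%:R + 1) `^ beta.
have M0 : 0 < M by rewrite !mulr_gt0// powR_gt0; lra.
have HM z : nrm z = r -> forall u, nrm u <= M * nrm (u - z *: T u).
  move=> zr u; apply: le_trans (HC z _ u) _; first by rewrite zr r2.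
  rewrite zr rV -(@powR_inv1 _ (n%:R + 1)) ?addr_ge0//.
  rewrite -powRrM mulN1r powRN invrK mulrA ler_wpM2r ?nrm_ge0//.
  rewrite mulrC /M -mulrA; apply: ler_wpM2r.
    by rewrite mulr_ge0 ?powR_ge0 ?ltW.
  by rewrite invf_ple ?posrE// ltW.
have dec : power_decay T r by apply: (power_decay_lt1 hT hsp); rewrite (ltW r0).
have := nrm_convolution_le r0 M0 HM dec (binc (g / 2)) n x l1.
under eq_bigr do rewrite binc_conv -splitr.
move=> h; apply: le_trans h _; rewrite ler_wpM2r ?nrm_ge0//.
have rn : r ^- n <= expR 1.
  rewrite -exprVn; have -> : r^-1 = 1 + (n%:R + 1)^-1 by rewrite -rV; ring.
  apply: (@le_trans _ _ (expR (n%:R + 1)^-1 ^+ n)).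
    by rewrite lerXn2r ?nnegrE ?expR_ge0 ?expR_ge1Dx// addr_ge0 ?invr_ge0
      ?addr_ge0.
  by rewrite -expRM_natr ler_expR ler_pdivrMl ?mulr1; lra.
have An : \sum_(i < n.+1) (binc (g / 2) i * r ^+ i) ^+ 2 <=
    K * (3 * n%:R) `^ (g - 1).
  apply: (@le_trans _ _ (K * \sum_(i < n.+1) binc (g - 1) i * (r ^+ 2) ^+ i)).
    rewrite mulr_sumr; apply: ler_sum => i _.
    rewrite exprMn [(r ^+ i) ^+ 2]exprAC mulrA; apply: ler_wpM2r.
      by rewrite exprn_ge0 ?sqr_ge0.
    by rewrite -gE; exact: HK.
  rewrite ler_pM2l//; apply: le_trans (binc_sum_le _ _ _) _; first lra.
    by rewrite sqr_ge0 expr_lt1 ?(ltW r0).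
  rewrite powRN; apply: (@le_trans _ _ ((1 - r) `^ (g - 1))^-1).
    rewrite lef_pV2 ?posrE ?powR_gt0 ?subr_gt0 ?expr_lt1 ?(ltW r0)//.
    apply: ge0_ler_powR; rewrite ?nnegrE ?subr_ge0 ?(ltW r1)//; first lra.
      by rewrite expr_le1 ?(ltW r0) ?(ltW r1).
    by rewrite lerB// expr2 ler_piMr ?(ltW r0) ?(ltW r1).
  rewrite r1V -(@powR_inv1 _ (n%:R + 2)) ?addr_ge0// -powRrM mulN1r powRN invrK.
  by apply: ge0_ler_powR; rewrite ?nnegrE; lra.
have Mn : M <= 2 * C * (3 * n%:R) `^ beta.
  rewrite /M ler_pM2l ?mulr_gt0//.
  by apply: ge0_ler_powR; rewrite ?nnegrE; lra.
have nE : (3 * n%:R) `^ (g - 1) * (3 * n%:R) `^ beta =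
    3 `^ (g + beta - 1) * n%:R `^ (g + beta - 1) :> R.
  rewrite -powRD; last by apply/implyP => _; rewrite mulf_neq0//; lra.
  by rewrite powRM//; congr (_ `^ _ * _ `^ _); ring.
have A0 : 0 <= \sum_(i < n.+1) (binc (g / 2) i * r ^+ i) ^+ 2.
  by apply: sumr_ge0 => i _; exact: sqr_ge0.
apply: le_trans (ler_pM _ _ (ler_pM _ _ rn An) Mn) _ => //.
- by rewrite mulr_ge0// invr_ge0 exprn_ge0// ltW.
- exact: ltW.
- by rewrite invr_ge0 exprn_ge0// ltW.
rewrite le_eqVlt; apply/orP; left; apply/eqP.
rewrite -[RHS]mulrA -nE; ring.
Qed.

End KreissToCesaro.

(** * From the Cesaro bounds to the Kreiss condition *)

Section CesaroToKreiss.
Variables (R : realType) (X : completeNormedModType R[i]).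

Lemma nrm_bound_continuous (S : X -> X) (M : R) : linear S ->
  (forall x, nrm (S x) <= M * nrm x) -> continuous S.
Proof.
move=> lS HM; pose m := GRing.isLinear.Build R[i] X X _ S lS.
pose SL : {linear X -> X} := HB.pack S m.
apply: (@bounded_linear_continuous _ _ _ SL); apply/linear_boundedP.
exists M%:C; split; first by rewrite complex_real.
case=> a b; rewrite ltcE /= => /andP[/eqP -> Mt] x; rewrite -/(a%:C).
rewrite !nrmE -rmorphM lecR; apply: le_trans (HM x) _.
by rewrite ler_wpM2r ?nrm_ge0// ltW.
Qed.

Lemma is_cvg_series_geometric_bound (u : nat -> X) (K q : R) : 0 <= q < 1 ->
  (forall n, nrm (u n) <= K * q ^+ n) -> cvgn (series u).
Proof.
move=> /andP[q0 q1] uK.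
have cg : cvgn (series (geometric K q)).
  by apply: is_cvg_geometric_series; rewrite ger0_norm.
apply/cauchy_cvgP/cauchy_seriesP => e e0.
have er : e = (complex.Re e)%:C by rewrite RRe_real ?gtr0_real.
have e0' : 0 < complex.Re e by move: e0; rewrite er ltcR.
move: cg => /cauchy_cvgP/cauchy_seriesP/(_ _ e0'); apply: filterS => n.
rewrite er nrmE ltcR; apply: le_lt_trans.
apply: le_trans (nrm_sum _ _ _) (le_trans _ (ler_norm _)).
by apply: ler_sum => k _; exact: uK.
Qed.

Lemma nrm_lim_series_le (u : nat -> X) (K q : R) : 0 <= q < 1 -> 0 <= K ->
  (forall n, nrm (u n) <= K * q ^+ n) -> nrm (limn (series u)) <= K / (1 - q).
Proof.
move=> q01 K0 uK; have /andP[q0 q1] := q01.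
apply/ler_addgt0Pl => e e0.
have cu := is_cvg_series_geometric_bound q01 uK.
have e0' : 0 < e%:C by rewrite (_ : 0 = 0%:C)// ltcR.
move/cvgrPdist_le : cu => /(_ _ e0') [n _ Hn].
have /= := Hn n (leqnn n); rewrite nrmE lecR => h.
rewrite -(subrK (series u n) (limn (series u))).
apply: le_trans (nrmD _ _) (lerD h _).
rewrite /series /=; apply: le_trans (nrm_sum _ _ _) _.
apply: (@le_trans _ _ (\sum_(0 <= k < n) K * q ^+ k)).
  by apply: ler_sum => k _; exact: uK.
rewrite -mulr_sumr ler_wpM2l// big_mkord.
have q1' : 0 < 1 - q by rewrite subr_gt0.
rewrite -[leRHS]mul1r ler_pdivlMr// mulrC.
have -> : (1 - q) * \sum_(k < n) q ^+ k = 1 - q ^+ n.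
  by rewrite -opprB mulNr -subrX1 opprB.
by rewrite gerBl exprn_ge0.
Qed.

Lemma cvg_real_scale (s : R^nat) (a : R) (x : X) : s @ \oo --> a ->
  (fun n => (s n)%:C *: x) @ \oo --> a%:C *: x.
Proof.
move=> sa; apply: cvgZr_tmp; apply/cvgrPdist_le => e e0.
have er : e = (complex.Re e)%:C by rewrite RRe_real ?gtr0_real.
have e0' : 0 < complex.Re e by move: e0; rewrite er ltcR.
move/cvgrPdist_le : sa => /(_ _ e0'); apply: filterS => n.
by rewrite er -rmorphB nrmE lecR nrm_real.
Qed.

Variable T : {linear X -> X}.
Hypothesis hT : continuous T.
Variables (g beta C : R).
Hypothesis g1 : 1 < g.
Hypothesis beta1 : 1 <= beta.
Hypothesis HC : forall l : R[i], nrm l = 1 ->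
  cesaro_bound g beta (fun x => l *: T x) C.

Let g0 : 0 < g. Proof. exact: lt_trans g1. Qed.

Lemma cesaro_sum0 l x : cesaro_sum g (fun x => l *: T x) 0 x = x.
Proof.
by rewrite cesaro_sum_scaleE// big_ord1 binc0 expr0 !scale1r.
Qed.

(** Coefficient form of (I - z l T) applied to the generating function of the sums, which gives (1 -
    z)^(-g). *)
Lemma cesaro_sumS l n x :
  cesaro_sum g (fun x => l *: T x) n.+1 x
  = (binc g n.+1)%:C *: x + l *: T (cesaro_sum g (fun x => l *: T x) n x).
Proof.
rewrite !cesaro_sum_scaleE// big_ord_recl /= subn0 expr0 scale1r.
congr (_ + _); rewrite linear_sum scaler_sumr; apply: eq_bigr => j _.
rewrite /bump /= add1n subSS ![T (_ *: _)]linearZ exprS !scalerA.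
by congr (_ *: _); ring.
Qed.

Lemma cesaro_sum_comm l n x :
  cesaro_sum g (fun x => l *: T x) n (T x)
  = T (cesaro_sum g (fun x => l *: T x) n x).
Proof.
rewrite !cesaro_sum_scaleE// linear_sum; apply: eq_bigr => j _.
by rewrite ![T (_ *: _)]linearZ -iterSr.
Qed.

Lemma cesaro_pencil_inverse : exists2 C1 : R, 0 < C1 &
  forall z, 0 < nrm z < 1 -> exists V : X -> X,
  [/\ linear V, forall x, V (x - z *: T x) = x,
      forall x, V x - z *: T (V x) = x &
      forall x, nrm (V x) <= C1 * (1 - nrm z) `^ (- beta) * nrm x].
Proof.
pose p := g + beta - 1; have p0 : 0 < p by move: g1 beta1; rewrite /p; lra.
have [K K0 HK] := powR_geometric_le p0.
have C0 : 0 < C by have [] := HC (nrm1 R).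
exists ((1 + C * K) * 2 `^ p * 2).
  by rewrite !mulr_gt0 ?powR_gt0// addr_gt0 ?mulr_gt0.
move=> z /andP[z0 z1]; set r := nrm z in z0 z1 *.
pose l := z / r%:C.
have rC0 : r%:C != 0 by rewrite (_ : 0 = 0%:C)// (inj_eq (@complexI R)) gt_eqF.
have zE : z = r%:C * l by rewrite /l mulrC divfK.
have l1 : nrm l = 1.
  by rewrite nrmM nrmV nrm_real gtr0_norm// mulfV// gt_eqF.
pose S n x := cesaro_sum g (fun x => l *: T x) n x.
pose u x n := (r ^+ n)%:C *: S n x.
(* r^n = q^n q^n: one factor absorbs the growth n^p, the other leaves a convergent geometric
   series. *)
pose q := Num.sqrt r.
have qr : q ^+ 2 = r by rewrite sqr_sqrtr ?ltW.
have q0 : 0 < q by rewrite sqrtr_gt0.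
have q1 : q < 1 by rewrite -(@expr_lt1 _ 2) ?qr// ltW.
have q01 : 0 <= q < 1 by rewrite (ltW q0).
(* The summand 1 handles n = 0, where the Cesaro sum is the identity and [cesaro_bound] gives no
   information. *)
pose D := 1 + C * K * (1 - q) `^ (- p).
have D1 : 1 <= D by rewrite lerDl !mulr_ge0 ?powR_ge0 ?ltW.
have uD x n : nrm (u x n) <= (D * nrm x) * q ^+ n.
  rewrite /u nrmZ nrm_real ger0_norm ?exprn_ge0 ?(ltW z0)// mulrC.
  have qn0 : 0 <= q ^+ n by rewrite exprn_ge0 ?(ltW q0).
  rewrite -qr exprAC expr2 mulrA; apply: ler_wpM2r => //.
  case: n qn0 => [|n] qn0.
    by rewrite /S cesaro_sum0 expr0 mulr1 ler_peMl ?nrm_ge0.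
  have [_ /(_ n.+1 isT) hS] := HC l1.
  pose m := GRing.isLinear.Build R[i] X X _ (S n.+1) (cesaro_sum_is_linear T g
    l n.+1).
  pose SL : {linear X -> X} := HB.pack (S n.+1) m.
  have h := nrm_le_opnorm (linearZ_LR SL) hS x.
  apply: le_trans (ler_wpM2r qn0 h) _.
  rewrite mulrAC; apply: ler_wpM2r; first exact: nrm_ge0.
  rewrite -mulrA -/p; apply: le_trans (ler_wpM2l (ltW C0) (HK q n.+1 _)) _.
    by rewrite q0.
  by rewrite mulrA /D lerDr.
have cu x : cvgn (series (u x)).
  exact: is_cvg_series_geometric_bound q01 (uD x).
pose U x := limn (series (u x)).
have lU : linear U.
  move=> a x y; apply/cvg_lim => //.
  have -> : series (u (a *: x + y)) =
      (fun n => a *: series (u x) n + series (u y) n).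
    apply/funext => n; rewrite /series /= scaler_sumr -big_split.
    apply: eq_bigr => k _ /=; rewrite /u /S (cesaro_sum_is_linear T g l k).
    by rewrite scalerDr !scalerA mulrC.
  by apply: cvgD; [apply: cvgZl_tmp|]; exact: cu.
(* Commutation with T makes the right inverse obtained below a left inverse too. *)
have UT x : U (T x) = T (U x).
  apply/cvg_lim => //.
  have -> : series (u (T x)) = T \o series (u x).
    apply/funext => n; rewrite /series /= linear_sum; apply: eq_bigr => k _.
    by rewrite /u /S cesaro_sum_comm [T (_ *: _)]linearZ.
  by apply: continuous_cvg; [exact: hT|exact: cu].
pose cg := ((1 - r) `^ g)%:C; pose V x := cg *: U x.
(* Multiplication by z T shifts the index by one, hence n + 1 terms against n; by [cesaro_sumS]
   everything cancels except the binomial partial sum. *)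
have partial x n : series (u x) n.+1 - z *: T (series (u x) n)
    = (pseries (binc g) r n.+1)%:C *: x.
  elim: n => [|n IH].
    rewrite /pseries /series /= !big_nat1 big_geq// linear0 scaler0 subr0.
    by rewrite /u /S cesaro_sum0 binc0 mul1r.
  rewrite (seriesSr (u x)) (seriesSr (u x) n) linearD scalerDr opprD addrACA.
  rewrite -(seriesSr (u x) n) IH.
  rewrite /pseries (seriesSr _ n.+1) rmorphD scalerDl; congr (_ + _).
  rewrite /u /S cesaro_sumS [T (_ *: _)]linearZ scalerDr.
  rewrite !scalerA zE -rmorphM /=.
  have -> : r%:C * l * (r ^+ n)%:C = (r ^+ n.+1)%:C * l.
    by rewrite exprS rmorphM /=; ring.
  by rewrite addrK mulrC.
have Ueq x : U x - z *: T (U x) = ((1 - r) `^ (- g))%:C *: x.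
  have c1 : (fun n => series (u x) n.+1 - z *: T (series (u x) n)) @ \oo
      --> U x - z *: T (U x).
    apply: cvgB; first by rewrite (cvg_shiftS (series (u x))); exact: cu.
    have cT : (fun n => T (series (u x) n)) @ \oo --> T (U x).
      by apply: (cvg_comp _ _ (cu x)); exact: hT.
    exact: cvgZl_tmp.
  have r1 : `|r| < 1 by rewrite gtr0_norm.
  have E : (fun n => series (u x) n.+1 - z *: T (series (u x) n)) =
      (fun n => (pseries (binc g) r n.+1)%:C *: x).
    by apply/funext => n; exact: partial.
  rewrite E in c1; apply: (cvg_unique _ c1) => //.
  apply: cvg_real_scale; rewrite (cvg_shiftS (pseries (binc g) r)).
  exact: cvg_binc.
have cgK : cg * ((1 - r) `^ (- g))%:C = 1.
  rewrite -rmorphM /= powRN mulfV// gt_eqF// powR_gt0// subr_gt0//.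
have V2 x : V x - z *: T (V x) = x.
  rewrite /V [T (_ *: _)]linearZ scalerA mulrC -scalerA -scalerBr Ueq.
  by rewrite scalerA cgK scale1r.
exists V; split=> //.
- by move=> a x y; rewrite /V lU scalerDr !scalerA mulrC.
- move=> x; rewrite -[RHS]V2 /V.
  have -> : U (x - z *: T x) = U x - z *: T (U x).
    by rewrite -UT addrC -scaleNr lU scaleNr addrC.
  by rewrite [T (_ *: _)]linearZ scalerBr !scalerA mulrC.
move=> x; rewrite /V nrmZ nrm_real ger0_norm ?powR_ge0//.
have hU : nrm (U x) <= D * nrm x / (1 - q).
  by apply: nrm_lim_series_le (uD x) => //; rewrite mulr_ge0 ?nrm_ge0//
    (le_trans _ D1).
have r1 : 0 < 1 - r by rewrite subr_gt0.
have q1' : 0 < 1 - q by rewrite subr_gt0.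
(* Here 1 - r = (1 - q) (1 + q) with 1 + q <= 2, so passing from q back to r costs only powers of
   2. *)
have qV : (1 - q)^-1 <= 2 / (1 - r).
  have -> : 1 - r = (1 - q) * (1 + q) by rewrite -qr; ring.
  rewrite invfM mulrA mulrAC ler_peMl ?invr_ge0 ?(ltW q1')//.
  by rewrite ler_pdivlMr; lra.
have qp : (1 - q) `^ (- p) <= 2 `^ p * (1 - r) `^ (- p).
  have powN a : 0 <= a -> a `^ (- p) = a^-1 `^ p.
    by move=> a0; rewrite -mulN1r powRrM powR_inv1.
  rewrite !powN ?(ltW r1) ?(ltW q1')// -powRM ?invr_ge0 ?(ltW r1)//.
  by apply: ge0_ler_powR; rewrite ?nnegrE ?mulr_ge0 ?invr_ge0 ?(ltW p0) ?(ltW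
    r1) ?(ltW q1').
have qp1 : 1 <= (1 - q) `^ (- p).
  rewrite powRN invf_ge1 ?powR_gt0//.
  apply: (@le_trans _ _ (1 `^ p)); last by rewrite powR1.
  by apply: ge0_ler_powR; rewrite ?nnegrE ?(ltW p0) ?(ltW q1') ?lerBlDr ?lerDl
    ?(ltW q0).
have DK : D <= (1 + C * K) * (2 `^ p * (1 - r) `^ (- p)).
  apply: (@le_trans _ _ ((1 + C * K) * (1 - q) `^ (- p))).
    by rewrite /D mulrDl mul1r lerD2r.
  by rewrite ler_wpM2l// addr_ge0// mulr_ge0 ?ltW.
have CK0 : 0 <= 1 + C * K by rewrite addr_ge0// mulr_ge0 ?ltW.
apply: (@le_trans _ _ ((1 - r) `^ g *
    ((1 + C * K) * (2 `^ p * (1 - r) `^ (- p)) * nrm x * (2 / (1 - r))))).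
  rewrite ler_wpM2l ?powR_ge0//; apply: le_trans hU _.
  apply: ler_pM => //; rewrite ?mulr_ge0 ?nrm_ge0 ?invr_ge0 ?(ltW q1')
    ?(le_trans _ D1)//.
  by rewrite ler_wpM2r ?nrm_ge0.
(* The exponents add up to g - p - 1 = - beta. *)
have bE : (1 - r) `^ (- beta) = (1 - r) `^ g * (1 - r) `^ (- p) * (1 - r)^-1.
  rewrite -(powR_inv1 (ltW r1)) -!powRD ?(gt_eqF r1) ?implybT//.
  by congr (_ `^ _); rewrite /p; ring.
by rewrite bE le_eqVlt; apply/orP; left; apply/eqP; field; rewrite gt_eqF.
Qed.

End CesaroToKreiss.

(** With z = l^-1 the resolvent is l^-1 times the inverse of I - z T. This works for all |l| > 1,
    which also confines the spectrum to the closed disk. *)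
Lemma cesaro_kreiss (R : realType) (X : completeNormedModType R[i])
    (T : {linear X -> X}) (g beta : R) : continuous T -> 1 < g -> 1 <= beta ->
  uniformly_cesaro_bounded g beta T -> kreiss_bounded beta T.
Proof.
move=> hT g1 b1 /uniformly_cesaro_boundedP [C HC].
have [C1 C10 HV] := cesaro_pencil_inverse hT g1 b1 HC.
have res l : 1 < `|l| -> exists2 S : X -> X, is_resolvent l T S &
    forall x, nrm (S x) <=
      (nrm l)^-1 * (C1 * (1 - (nrm l)^-1) `^ (- beta)) * nrm x.
  rewrite nrmE (_ : 1 = (1 : R)%:C :> R[i])// ltcR => l1.
  have l0 : l != 0 by rewrite -nrm_eq0 gt_eqF// (lt_trans _ l1).
  have z01 : 0 < nrm l^-1 < 1.
    by rewrite nrmV invr_gt0 invf_lt1 ?l1 ?andbT// (lt_trans _ l1).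
  have [V [lV V1 V2 bV]] := HV _ z01.
  have bS x : nrm (l^-1 *: V x) <=
      (nrm l)^-1 * (C1 * (1 - (nrm l)^-1) `^ (- beta)) * nrm x.
    by rewrite nrmZ nrmV -mulrA ler_wpM2l ?invr_ge0 ?nrm_ge0// -nrmV bV.
  have lS : linear (fun x => l^-1 *: V x).
    by move=> a x y; rewrite lV scalerDr !scalerA mulrC.
  exists (fun x => l^-1 *: V x) => //; split=> // [|x|x].
  - exact: nrm_bound_continuous lS bS.
  - have -> : l *: x - T x = l *: (x - l^-1 *: T x) + 0.
      by rewrite addr0 scalerBr scalerA mulfV// scale1r.
    have V0 : V 0 = 0.
      by have := lV (-1) 0 0; rewrite scaler0 addr0 scaleN1r addNr.
    by rewrite lV V0 addr0 scalerA mulVf// scale1r V1.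
  - by rewrite scalerA mulfV// scale1r linearZ_LR V2.
split.
  move=> l; rewrite /spectrum /= => hl; rewrite real_leNgt ?normr_real ?real1//.
  by apply/negP => l1; apply: hl; have [S HS _] := res l l1; exists S.
(* (1 - 1 / |l|)^(-beta) = |l|^beta (|l| - 1)^(-beta), and |l| < 2. *)
exists (C1 * 2 `^ beta); split; first by rewrite mulr_gt0 ?powR_gt0.
move=> l /andP[l1 l2]; have [S HS bS] := res l l1.
have [_ _ Q1 _] : is_resolvent l T (resolvent l T) by apply: getPex; exists S.
case: HS => lS _ S1 S2.
move: l1 l2; rewrite -/(nrm l) nrmE (_ : 2 = (2 : R)%:C); last by rewrite
  rmorph_nat.
rewrite (_ : 1 = (1 : R)%:C :> R[i])// !ltcR => l1 l2.
have l0 : 0 < nrm l by rewrite (lt_trans _ l1).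
apply: opnorm_le => [|x].
  by rewrite divr_ge0 ?mulr_ge0 ?powR_ge0 ?ltW.
(* [resolvent] is a chosen inverse; it agrees with S because a left inverse and a right inverse
   coincide. *)
have -> : resolvent l T x = S x by rewrite -{1}(S2 x) Q1.
apply: le_trans (bS x) _; rewrite ler_wpM2r ?nrm_ge0//.
have -> : 1 - (nrm l)^-1 = (nrm l - 1) * (nrm l)^-1.
  by rewrite mulrBl mulfV ?gt_eqF// mul1r.
have d0 : 0 <= nrm l - 1 by rewrite subr_ge0 ltW.
rewrite powRN powRM ?invr_ge0 ?(ltW l0)// invfM mulrCA -mulrA ler_pM2l//.
rewrite mulrCA [leRHS]mulrC ler_wpM2l ?invr_ge0 ?powR_ge0//.
rewrite -powRN -(powR_inv1 (ltW l0)) -powRrM mulrN mulN1r opprK.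
rewrite (powR_inv1 (ltW l0)); apply: (@le_trans _ _ (1 * nrm l `^ beta)).
  by rewrite ler_wpM2r ?powR_ge0// invf_le1// ltW.
rewrite mul1r; apply: ge0_ler_powR; rewrite ?nnegrE ?(ltW l0) ?(ltW l2)//.
exact: le_trans b1.
Qed.

Theorem proposition5p8 (R : realType) (X : completeNormedModType R[i])
    (T : {linear X -> X}) (hT : continuous T) (beta : R) (hbeta : 1 <= beta) :
  [<-> kreiss_bounded beta T;
       forall gamma : R, 1 < gamma -> uniformly_cesaro_bounded gamma beta T;
       exists gamma : R, 1 < gamma /\ uniformly_cesaro_bounded gamma beta T].
Proof.
split=> [hk gamma g1|]; first exact: kreiss_cesaro.
split=> [h|[gamma [g1 h]]]; last exact: cesaro_kreiss h.
by exists 2; split; [rewrite ltr1n|apply: h; rewrite ltr1n].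
Qed.
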